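(* Let $\varphi:\mathbb{R}\to\mathbb{R}$ be continuous and nondecreasing, let $\mu\ge0$ be an even Radon measure on $\mathbb{R}^N\setminus\{0\}$ with $\int_{|z|\le1}|z|^2\mu(\mathrm{d}z)+\int_{|z|>1}\mu(\mathrm{d}z)<\infty$, let $u_0\in L^\infty(\mathbb{R}^N)$ and $u\in L^\infty(Q_T)$. Then the following are equivalent: (a) $u$ is an energy solution of $\partial_tu-\mathcal{L}^\mu[\varphi(u)]=0$ in $Q_T$, $u(\cdot,0)=u_0$ on $\mathbb{R}^N$. (b) $u$ is a distributional solution of $\partial_tu-\mathcal{L}^\mu[\varphi(u)]=0$ in $Q_T$, $u(\cdot,0)=u_0$ on $\mathbb{R}^N$, such that $\varphi(u)\in L^2(0,T;E_\mu(\mathbb{R}^N))$.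
   Context: $T>0$, $Q_T:=\mathbb{R}^N\times(0,T)$; $\mu$ even means $\mu(B)=\mu(-B)$ for all Borel $B$. The operator is $$\mathcal{L}^\mu[\phi](x)=\int_{\mathbb{R}^N\setminus\{0\}}\big(\phi(x+z)-\phi(x)-z\cdot D\phi(x)\mathbf{1}_{|z|\le1}\big)\mu(\mathrm{d}z).$$ Set $\mathcal{E}_\mu[f,g]:=\frac12\int_{\mathbb{R}^N}\int_{|z|>0}(f(x+z)-f(x))(g(x+z)-g(x))\,\mu(\mathrm{d}z)\mathrm{d}x$, $|f|_{E_\mu}^2:=\mathcal{E}_\mu[f,f]$, and $L^2(0,T;E_\mu(\mathbb{R}^N)):=\{f:Q_T\to\mathbb{R}\text{ measurable}:\int_0^T|f(\cdot,t)|_{E_\mu}^2\mathrm{d}t<\infty\}$. Energy solution: $u\in L^1_{\mathrm{loc}}(Q_T)$ with $\varphi(u)\in L^2(0,T;E_\mu(\mathbb{R}^N))$ and, for all $\psi\in C_c^\infty(\mathbb{R}^N\times[0,T))$, $\int_0^T\big(\int_{\mathbb{R}^N}u\,\partial_t\psi\,\mathrm{d}x-\mathcal{E}_\mu[\varphi(u),\psi]\big)\mathrm{d}t+\int_{\mathbb{R}^N}u_0(x)\psi(x,0)\,\mathrm{d}x=0$. Distributional solution: $u\in L^1_{\mathrm{loc}}(Q_T)$ such that, for all $\psi\in C_c^\infty(\mathbb{R}^N\times[0,T))$, $\iint_{Q_T}\big(u\,\partial_t\psi+\varphi(u)\mathcal{L}^\mu[\psi]\big)\mathrm{d}x\mathrm{d}t+\int_{\mathbb{R}^N}u_0(x)\psi(x,0)\,\mathrm{d}x=0$.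 *)

(* Defs.v *)
From HB Require Import structures.
From mathcomp Require Import all_boot all_order all_algebra.
From mathcomp Require Import all_classical all_reals all_analysis.
From mathcomp Require Import measurable_realfun.

Set Implicit Arguments.
Unset Strict Implicit.
Unset Printing Implicit Defensive.

Import Order.TTheory GRing.Theory Num.Theory.
Import numFieldNormedType.Exports.

Local Open Scope classical_set_scope.
Local Open Scope ring_scope.

Section borel_mx.
Context (R : realType) (m n : nat).
Let G : set (set 'M[R]_(m, n)) := open.

HB.instance Definition _ := @isMeasurable.Build (sigma_display G) 'M[R]_(m, n)
  <<s G >> (@sigma_algebra0 _ setT G) (@sigma_algebraC _ G)
  (@sigma_algebra_bigcup _ setT G).

Lemma open_measurable_mx (A : set 'M[R]_(m, n)) : open A -> measurable A.
Proof. exact: sub_sigma_algebra. Qed.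

End borel_mx.

(* Lebesgue measure on R^n is built as an iterated product, transported along
   R * R^n -> R^(n+1); lebesgue_rV_box below gives its values on boxes. *)
Definition cons_rV (R : realType) (n : nat)
    (p : measurableTypeR R * 'rV[R]_n) : 'rV[R]_n.+1 :=
  row_mx (p.1)%:M p.2 : 'rV_(1 + n).

Fixpoint lebesgue_rV (R : realType) (n : nat) : set 'rV[R]_n -> \bar R :=
  match n with
  | 0 => dirac (0 : 'rV[R]_0)
  | k.+1 => pushforward (lebesgue_measure \x @lebesgue_rV R k)%E (@cons_rV R k)
  end.
Arguments lebesgue_rV {R} n.

Section lebesgue_rV_measure.
Context {R : realType}.

Let rbox n (q : rat * 'rV[rat]_n) (k : nat) : set (measurableTypeR R * 'rV[R]_n) :=
  ball (ratr q.1 : R) k.+1%:R^-1 `*` ball (map_mx ratr q.2 : 'rV[R]_n) k.+1%:R^-1.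

Let open_prod_measurable n (U : set (R * 'rV[R]_n)) :
  open U -> measurable (U : set (measurableTypeR R * 'rV[R]_n)).
Proof.
move=> oU.
have -> : U = \bigcup_(p in [set p : (rat * 'rV[rat]_n) * nat |
    rbox p.1 p.2 `<=` U]) rbox p.1 p.2.
  apply/seteqP; split=> [[x v] Uxv|xv [p pU /pU//]].
  move: oU; rewrite openE => /(_ _ Uxv) /nbhs_ballP[e /= e0 eU].
  have [k ke] : exists k : nat, k.+1%:R^-1 < e / 2.
    have [k ?] := ltr_add_invr (y := 0) (x := e / 2) (divr_gt0 e0 (ltr0Sn R 1)).
    by exists k; rewrite -[X in X < _]add0r.
  have approx (r : R) : exists q : rat, ball (ratr q : R) k.+1%:R^-1 r.
    have : r < r + k.+1%:R^-1 by rewrite ltrDl.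
    move=> /rat_in_itvoo[q /itvP qr]; exists q.
    rewrite /ball/= ltr_distl qr andbT ltrBlDr.
    by rewrite (@lt_trans _ _ (ratr q)) ?qr// ltrDl invr_gt0.
  have [qx hx] := approx x.
  have /choice[qv hv] := fun i => approx (v ord0 i).
  exists ((qx, \row_i qv i), k); last first.
    split => //=; split; first by rewrite invr_gt0.
    by move=> i j; rewrite ord1 !mxE; exact: hv.
  move=> [y w] [/= hy [_ hw]]; apply: eU; split => /=.
    apply: (@le_ball _ _ _ (k.+1%:R^-1 + k.+1%:R^-1)).
      by rewrite [leRHS]splitr lerD// ltW.
    by apply: ball_triangle hy; exact: ball_sym.
  split=> // i j; rewrite ord1.
  apply: (@le_ball _ _ _ (k.+1%:R^-1 + k.+1%:R^-1)).
    by rewrite [leRHS]splitr lerD// ltW.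
  have := hw ord0 j; rewrite !mxE; apply: ball_triangle; exact: ball_sym.
rewrite bigcup_mkcond; apply: countable_bigcupT_measurable => // -[q k].
case: ifP => // _; apply: measurableX.
  by apply: open_measurable; apply: ball_open; rewrite ?invr_gt0.
by apply: open_measurable_mx; apply: ball_open; rewrite ?invr_gt0.
Qed.

Lemma continuous_cons_rV n :
  continuous (@cons_rV R n : R * 'rV[R]_n -> 'rV[R]_n.+1).
Proof.
move=> xv A /nbhs_ballP[e /= e0 eA].
rewrite nbhs_simpl; apply/(nbhs_ballP xv).
exists e => //=; case: xv eA => x v eA [y w] [/= xy [_ vw]].
apply: eA; split=> // i j; rewrite /cons_rV -[j](@splitK 1 n).
case: (@fintype.split 1 n j) => {}j /=.
  by rewrite !(@row_mxEl _ _ 1 n) !mxE !ord1 eqxx !mulr1n.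
by rewrite !(@row_mxEr _ _ 1 n).
Qed.

Lemma measurable_cons_rV n : measurable_fun [set: _] (@cons_rV R n).
Proof.
apply: (@measurability _ _ _ _ _ _ (open : set (set 'rV[R]_n.+1))) => //.
move=> _ [A oA <-]; rewrite setTI; apply: open_prod_measurable.
by move/continuousP: (@continuous_cons_rV n); exact.
Qed.

Local Notation cube n k := (ball (0 : 'rV[R]_n) k.+1%:R)%R.

Section step.
Context n (m : {sigma_finite_measure set 'rV[R]_n -> \bar R}).

Definition lebesgue_cons := pushforward (lebesgue_measure \x m)%E (@cons_rV R n).
Local Notation nu := lebesgue_cons.

Let mpre A : measurable A -> measurable (@cons_rV R n @^-1` A).
Proof. by move=> mA; rewrite -[X in measurable X]setTI; exact: measurable_cons_rV. Qed.

Let nu0 : nu set0 = 0%E.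
Proof. by rewrite /lebesgue_cons /pushforward preimage_set0 measure0. Qed.

Let nu_ge0 A : (0 <= nu A)%E.
Proof. by rewrite /lebesgue_cons /pushforward measure_ge0. Qed.

Let nu_sigma_additive : semi_sigma_additive nu.
Proof.
move=> F mF tF mUF; rewrite /lebesgue_cons /pushforward preimage_bigcup.
apply: measure_semi_sigma_additive.
- by move=> k; exact: mpre.
- apply/trivIsetP => /= i j _ _ ij; rewrite -preimage_setI.
  by move/trivIsetP : tF => /(_ _ _ _ _ ij) ->//; rewrite preimage_set0.
- by rewrite -preimage_bigcup; exact: mpre.
Qed.

HB.instance Definition _ := isMeasure.Build _ _ _ nu
  nu0 nu_ge0 nu_sigma_additive.

Hypothesis m_ball : forall k, (m (cube n k) < +oo)%E.

Let preball k : @cons_rV R n @^-1` cube n.+1 k =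
  (ball (0 : R) k.+1%:R : set (measurableTypeR R)) `*` cube n k.
Proof.
apply/seteqP; split=> [[x v] [k0 /= xv]|[x v] /= [h0 [k0 hv]]].
  split; [have := xv ord0 (lshift n (ord0 : 'I_1))|split=> // i j;
    have := xv i (@rshift 1 n j)]; rewrite /cons_rV.
    by rewrite (@row_mxEl _ _ 1 n) !mxE mulr1n.
  by rewrite (@row_mxEr _ _ 1 n) !mxE.
split=> // i j; rewrite /cons_rV -[j](@splitK 1 n).
case: (@fintype.split 1 n j) => {}j /=.
  by rewrite (@row_mxEl _ _ 1 n) !mxE !ord1 eqxx mulr1n.
by rewrite (@row_mxEr _ _ 1 n) mxE; have := hv i j; rewrite mxE.
Qed.

Let nu_ball k : (nu (cube n.+1 k) < +oo)%E.
Proof.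
rewrite /lebesgue_cons /pushforward preball product_measure1E.
- rewrite [X in (X * _)%E](@lebesgue_measure_ball R 0 k.+1%:R)//.
  by rewrite lte_mul_pinfty// ?lee_fin ?ltry// m_ball.
- by apply: open_measurable; apply: ball_open; rewrite ?invr_gt0.
- by apply: open_measurable_mx; apply: ball_open; rewrite ?invr_gt0.
Qed.

Lemma bigcup_ballT (k : nat) : \bigcup_i cube k i = setT.
Proof.
apply/seteqP; split=> // v _.
exists (Num.truncn `|v|) => //=.
by rewrite -ball_normE/= sub0r normrN truncnS_gt.
Qed.

Let nu_sigma_finite : sigma_finite setT nu.
Proof.
exists (fun k => cube n.+1 k) => [|k]; first by rewrite bigcup_ballT.
by split; [by apply: open_measurable_mx; apply: ball_open|exact: nu_ball].
Qed.

HB.instance Definition _ := @Measure_isSigmaFinite.Build _ _ _ nu nu_sigma_finite.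

Lemma lebesgue_rV_step : exists2 m' : {sigma_finite_measure set 'rV[R]_n.+1 -> \bar R},
  pushforward (lebesgue_measure \x m)%E (@cons_rV R n) = m' &
  forall k, (m' (cube n.+1 k) < +oo)%E.
Proof. by exists (nu : {sigma_finite_measure set _ -> \bar R}). Qed.

End step.

Lemma lebesgue_rV_sigma_finite_measure n :
  exists2 m : {sigma_finite_measure set 'rV[R]_n -> \bar R},
    lebesgue_rV n = m & forall k : nat, (m (cube n k) < +oo)%E.
Proof.
elim: n => [|n [m IH moo]].
  exists (dirac (0 : 'rV[R]_0) : {sigma_finite_measure set 'rV[R]_0 -> \bar R}) => //.
  by move=> k; rewrite /= diracE ltry.
by rewrite /= IH; exact: lebesgue_rV_step.
Qed.

Context (n : nat).

Let leb0 : lebesgue_rV n set0 = 0%E :> \bar R.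
Proof. by have [m -> _] := lebesgue_rV_sigma_finite_measure n; exact: measure0. Qed.

Let leb_ge0 A : (0 <= lebesgue_rV n A :> \bar R)%E.
Proof. by have [m -> _] := lebesgue_rV_sigma_finite_measure n. Qed.

Let leb_sigma_additive : semi_sigma_additive (@lebesgue_rV R n).
Proof.
by have [m -> _] := lebesgue_rV_sigma_finite_measure n;
  exact: measure_semi_sigma_additive.
Qed.

HB.instance Definition _ := isMeasure.Build _ _ _ (@lebesgue_rV R n)
  leb0 leb_ge0 leb_sigma_additive.

Let leb_sigma_finite : sigma_finite setT (@lebesgue_rV R n).
Proof.
by have [m -> _] := lebesgue_rV_sigma_finite_measure n; exact: sigma_finiteT.
Qed.

HB.instance Definition _ := @Measure_isSigmaFinite.Build _ _ _
  (@lebesgue_rV R n) leb_sigma_finite.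

End lebesgue_rV_measure.

Lemma lebesgue_rV_box (R : realType) n (a b : 'rV[R]_n) :
  (forall i, a ord0 i <= b ord0 i) ->
  lebesgue_rV n [set x : 'rV[R]_n | forall i, a ord0 i <= x ord0 i <= b ord0 i] =
  (\prod_i (b ord0 i - a ord0 i))%:E.
Proof.
elim: n a b => [|n IH] a b ab.
  rewrite big_ord0 /= diracE mem_set//=; by case.
pose tl (c : 'rV[R]_n.+1) := \row_(i < n) c ord0 (lift ord0 i).
set A := [set x : 'rV[R]_n.+1 | _]; rewrite big_ord_recl EFinM.
rewrite -[lebesgue_rV n.+1 _]/((lebesgue_measure \x lebesgue_rV n)%E (@cons_rV R n @^-1` A)).
have IHab := IH (tl a) (tl b).
set B := [set x : 'rV[R]_n | forall i, tl a ord0 i <= x ord0 i <= tl b ord0 i] in IHab.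
have cons0 (p : measurableTypeR R * 'rV[R]_n) : cons_rV p ord0 ord0 = p.1.
  rewrite /cons_rV (_ : ord0 = @lshift 1 n ord0); last exact/val_inj.
  by rewrite (@row_mxEl _ _ 1 n) mxE eqxx mulr1n.
have consS (p : measurableTypeR R * 'rV[R]_n) i :
    cons_rV p ord0 (lift ord0 i) = p.2 ord0 i.
  rewrite /cons_rV (_ : lift ord0 i = @rshift 1 n i); last exact/val_inj.
  by rewrite (@row_mxEr _ _ 1 n).
rewrite (_ : @cons_rV R n @^-1` A = `[a ord0 ord0, b ord0 ord0] `*` B); last first.
  apply/seteqP; split=> [p /= H|p [/= p1 p2] i].
    split; first by have := H ord0; rewrite cons0 in_itv.
    by move=> i; have := H (lift ord0 i); rewrite consS !mxE.
  case: (unliftP ord0 i) => [j|] ->; first by rewrite consS; have := p2 j; rewrite !mxE.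
  by rewrite cons0; move: p1; rewrite in_itv.
have mB : measurable B.
  have -> : B = ~` \bigcup_(i : 'I_n) ((fun x : 'rV[R]_n => x ord0 i) @^-1`
      (`]-oo, (tl a ord0 i)[%classic `|` `](tl b ord0 i), +oo[%classic)).
    apply/seteqP; split=> [x Bx [i _ /=]|x Bx i].
      by rewrite !in_itv/= andbT; have /andP[? ?] := Bx i; rewrite !ltNge => -[]/negP.
    rewrite !leNgt -negb_or; apply/negP => /orP H; apply: Bx; exists i => //=.
    by rewrite !in_itv/= andbT.
  apply: measurableC; apply: open_measurable_mx; apply: bigcup_open => i _.
  apply: open_comp; first by move=> x _; exact: coord_continuous.
  by apply: openU; apply: interval_open.
rewrite product_measure1E//=.
rewrite [X in (X * _)%E](lebesgue_measure_itv `[a ord0 ord0, b ord0 ord0])/=.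
rewrite IHab; last by move=> i; rewrite !mxE.
rewrite lte_fin; rewrite (_ : (if _ then _ else _) = (b ord0 ord0 - a ord0 ord0)%:E); last first.
  by have := ab ord0; rewrite le_eqVlt => /predU1P[->|->//]; rewrite ltxx subrr.
congr (_ * _%:E)%E; by apply: eq_bigr => i _; rewrite !mxE.
Qed.

Section euclidean.
Context {R : realType} {N : nat}.
Implicit Types (x y z : 'rV[R]_N) (f : 'rV[R]_N -> R).

Definition dotp x y : R := \sum_(i < N) x ord0 i * y ord0 i.

(* The norm `|x| of the library on row vectors is the sup norm. *)
Definition enorm x : R := Num.sqrt (dotp x x).

Definition gradient f x : 'rV[R]_N :=
  \row_(i < N) 'D_(delta_mx ord0 i : 'rV[R]_N) f x.

Definition punctured : set 'rV[R]_N := [set z | z != 0].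

Definition unit_ball : set 'rV[R]_N := [set z | enorm z <= 1].

End euclidean.
Arguments punctured {R} N.
Arguments unit_ball {R} N.

(* A measure on R^N \ {0} is represented by a Borel measure on R^N of which only
   the values on subsets of [punctured N] are ever used. *)
Section levy_measure.
Context {R : realType} {N : nat} (mu : {measure set 'rV[R]_N -> \bar R}).
Local Open Scope ereal_scope.

Definition radon_punctured : Prop :=
  (forall K : set 'rV[R]_N, compact K -> K `<=` punctured N -> mu K < +oo) /\
  (forall B : set 'rV[R]_N, measurable B -> B `<=` punctured N ->
    mu B = ereal_sup [set mu K | K in
      [set K : set 'rV[R]_N | compact K /\ K `<=` B]]).

Definition even_measure : Prop :=
  forall B : set 'rV[R]_N, measurable B -> B `<=` punctured N ->
    mu B = mu [set (- z)%R | z in B].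

Definition levy_integrable : Prop :=
  \int[mu]_(z in punctured N `&` unit_ball N)
    (enorm z ^+ 2)%:E +
  \int[mu]_(z in ~` unit_ball N) 1 < +oo.

Definition levy_operator (f : 'rV[R]_N -> R) (x : 'rV[R]_N) : R :=
  (\int[mu]_(z in punctured N)
     (f (x + z) - f x - dotp z (gradient f x) * \1_(unit_ball N) z))%R.

Definition energy (f g : 'rV[R]_N -> R) : \bar R :=
  (2^-1)%:E * \int[lebesgue_rV N]_x \int[mu]_(z in punctured N)
    ((f (x + z) - f x) * (g (x + z) - g x))%:E.

End levy_measure.

Section smooth.
Context {R : realType} {V : normedModType R}.

Definition iter_derive (vs : seq V) (f : V -> R) : V -> R :=
  foldr (fun v (g : V -> R) => 'D_v g) f vs.

Definition smooth (f : V -> R) : Prop :=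
  forall vs : seq V, continuous (iter_derive vs f) /\
    forall x v, derivable (iter_derive vs f) x v.

End smooth.

(* A function on R^N x (0, T) is represented by a function on 'rV[R]_N * R whose
   values outside [cylinder] are irrelevant.  For measurability the time line is
   written measurableTypeR R, the domain of lebesgue_measure. *)
Section cauchy_problem.
Context {R : realType} {N : nat} (T : R).
Local Open Scope ereal_scope.

Local Notation spacetime_measure := (lebesgue_rV N \x @lebesgue_measure R).

Definition cylinder : set ('rV[R]_N * R) := [set p | (0 < p.2 < T)%R].

Definition Linfty_cylinder (u : 'rV[R]_N * R -> R) : Prop :=
  ((u \_ cylinder)%R : 'rV[R]_N * measurableTypeR R -> R)
    \in Lfun spacetime_measure +oo.

Definition L1loc_cylinder (u : 'rV[R]_N * R -> R) : Prop :=
  @measurable_fun _ _ ('rV[R]_N * measurableTypeR R)%type R cylinder u /\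
  forall K : set ('rV[R]_N * R), compact K -> K `<=` cylinder ->
    \int[spacetime_measure]_(p in K) `|u p|%:E < +oo.

(* The class C_c^oo(R^N x [0, T)): smooth up to t = 0, as the restriction of a
   smooth function on R^N x R, with a compact support in R^N x [0, T) that may
   meet {t = 0}. *)
Definition test_function (psi : 'rV[R]_N * R -> R) : Prop :=
  smooth psi /\
  exists K : set ('rV[R]_N * R),
    [/\ compact K, K `<=` [set p | (0 <= p.2 < T)%R] &
      forall p, (0 <= p.2 < T)%R -> ~ K p -> psi p = 0%R].

Definition dt (psi : 'rV[R]_N * R -> R) (p : 'rV[R]_N * R) : R :=
  derive1 (fun t => psi (p.1, t)) p.2.

Context (mu : {measure set 'rV[R]_N -> \bar R}).

Definition slice (f : 'rV[R]_N * R -> R) (t : R) : 'rV[R]_N -> R :=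
  fun x => f (x, t).

Definition L2_energy (f : 'rV[R]_N * R -> R) : Prop :=
  @measurable_fun _ _ ('rV[R]_N * measurableTypeR R)%type R cylinder f /\
  \int[lebesgue_measure]_(t in `]0%R, T[)
    energy mu (slice f t) (slice f t) < +oo.

Context (phi : R -> R) (u0 : 'rV[R]_N -> R).

Definition energy_solution (u : 'rV[R]_N * R -> R) : Prop :=
  [/\ L1loc_cylinder u, L2_energy (phi \o u) &
    forall psi, test_function psi ->
      \int[lebesgue_measure]_(t in `]0%R, T[)
        (\int[lebesgue_rV N]_x (u (x, t) * dt psi (x, t))%:E
         - energy mu (slice (phi \o u) t) (slice psi t))
      + \int[lebesgue_rV N]_x (u0 x * psi (x, 0%R))%:E = 0].

Definition distributional_solution (u : 'rV[R]_N * R -> R) : Prop :=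
  L1loc_cylinder u /\
  forall psi, test_function psi ->
    \int[spacetime_measure]_(p in cylinder)
      (u p * dt psi p + phi (u p) * levy_operator mu (slice psi p.2) p.1)%:E
    + \int[lebesgue_rV N]_x (u0 x * psi (x, 0%R))%:E = 0.

End cauchy_problem.

(* Main.v *)
(* For a test function psi, both weak formulations carry the same term in u_0, so
   it suffices to compare their space-time integrals, and, by Fubini, to prove
   E(F, psi) = - \int F L(psi) dx for almost every time, with F = phi(u).  Write
   tau(x, z) = psi(x + z) - psi(x) - z.D psi(x) 1_{|z| <= 1} and H = F(x) tau(x, z).
   The flip S : (x, z) |-> (x + z, - z) preserves dx mu(dz), because Lebesgue
   measure is translation invariant and mu is even, and the energy integrand is
     (F(x + z) - F(x)) (psi(x + z) - psi(x)) = - H - H o S + W(x + z, z) - W(x, z)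
   with W(x, z) = F(x) z.D psi(x) 1_{|z| <= 1}.  The first three terms are
   integrable (finite energy of F and psi, and Taylor's formula), hence so is the
   last difference, whose integral over x vanishes for every z.  Therefore the
   double integral of the energy integrand is - 2 \iint H. *)
Require Import Defs.
From HB Require Import structures.
From mathcomp Require Import all_boot all_order all_algebra.
From mathcomp Require Import all_classical all_reals all_analysis.
From mathcomp Require Import measurable_realfun ess_sup_inf ring lra.

Set Implicit Arguments.
Unset Strict Implicit.
Unset Printing Implicit Defensive.

Import Order.TTheory GRing.Theory Num.Theory.
Import numFieldNormedType.Exports.

Local Open Scope classical_set_scope.
Local Open Scope ring_scope.

(** * Measurability of open sets and continuous maps on products *)

Section borel_product.
Context {R : realType}.

(** The sigma-algebra of a product is generated by measurable rectangles, whereas continuity only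
    speaks of open sets. This is the bridge: [U] is the union of the rectangles [B1 i] x [B2 j] it
    contains, of which there are countably many. *)
Lemma measurable_countable_rectangles d1 d2 (T1 : measurableType d1)
    (T2 : measurableType d2) (I J : countType)
    (B1 : I -> set T1) (B2 : J -> set T2) (U : set (T1 * T2)) :
  (forall i, measurable (B1 i)) -> (forall j, measurable (B2 j)) ->
  (forall p, U p -> exists i j, [/\ B1 i p.1, B2 j p.2 & B1 i `*` B2 j `<=` U]) ->
  measurable U.
Proof.
move=> mB1 mB2 UB.
have -> : U = \bigcup_(k in [set k : I * J | B1 k.1 `*` B2 k.2 `<=` U])
    (B1 k.1 `*` B2 k.2).
  apply/seteqP; split=> [p Up|p [k kU /kU//]].
  by have [i [j [? ? ?]]] := UB _ Up; exists (i, j).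
rewrite bigcup_mkcond; apply: countable_bigcupT_measurable => // k.
by case: ifPn => // _; exact: measurableX.
Qed.

(** Rational centres and radii 1/(k+1) give a countable basis of the topology, here of R and below
    of R^n with the sup norm. *)
Let rat_ball (k : rat * nat) : set R := ball (ratr k.1 : R) k.2.+1%:R^-1.

Let rat_ball_mx n (k : 'rV[rat]_n * nat) : set 'rV[R]_n :=
  ball (map_mx ratr k.1 : 'rV[R]_n) k.2.+1%:R^-1.

Let small_inv (e : R) : 0 < e -> exists k : nat, k.+1%:R^-1 < e / 2.
Proof.
move=> e0; have [k ?] := ltr_add_invr (y := 0) (x := e / 2) (divr_gt0 e0 (ltr0Sn R 1)).
by exists k; rewrite -[X in X < _]add0r.
Qed.

Let approx_rat (r : R) k : exists q : rat, ball (ratr q : R) k.+1%:R^-1 r.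
Proof.
have : r < r + k.+1%:R^-1 by rewrite ltrDl.
move=> /rat_in_itvoo[q /itvP qr]; exists q.
rewrite /ball/= ltr_distl qr andbT ltrBlDr.
by rewrite (@lt_trans _ _ (ratr q)) ?qr// ltrDl invr_gt0.
Qed.

Let half_ball (V : pseudoMetricType R) (a x : V) (e : R) k : k.+1%:R^-1 < e / 2 ->
  ball a k.+1%:R^-1 x -> ball a k.+1%:R^-1 `<=` ball x e.
Proof.
move=> ke ax y ay; apply: (@le_ball _ _ _ (k.+1%:R^-1 + k.+1%:R^-1)).
  by rewrite [leRHS]splitr lerD// ltW.
by apply: ball_triangle ay; exact: ball_sym.
Qed.

Let rat_ball_basis (x e : R) : 0 < e -> exists k, rat_ball k x /\ rat_ball k `<=` ball x e.
Proof.
move=> /small_inv[k ke]; have [q qx] := approx_rat x k.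
by exists (q, k); split => //; exact: half_ball.
Qed.

Let rat_ball_mx_basis n (x : 'rV[R]_n) (e : R) : 0 < e ->
  exists k, rat_ball_mx k x /\ rat_ball_mx k `<=` ball x e.
Proof.
move=> /small_inv[k ke].
have /choice[q qx] := fun i => approx_rat (x ord0 i) k.
suff qx' : rat_ball_mx (\row_i q i, k) x.
  by exists (\row_i q i, k); split => //; exact: half_ball.
by split=> [|i j]; rewrite ?invr_gt0// ord1 !mxE; exact: qx.
Qed.

Let measurable_rat_ball k : measurable (rat_ball k : set (measurableTypeR R)).
Proof. by apply: open_measurable; apply: ball_open; rewrite ?invr_gt0. Qed.

Let measurable_rat_ball_mx n k : measurable (@rat_ball_mx n k).
Proof. by apply: open_measurable_mx; apply: ball_open; rewrite ?invr_gt0. Qed.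

Lemma open_measurable_rV_R n (U : set ('rV[R]_n * R)) :
  open U -> measurable (U : set ('rV[R]_n * measurableTypeR R)).
Proof.
move=> oU; apply: (measurable_countable_rectangles
  (@measurable_rat_ball_mx n) measurable_rat_ball) => -[x t] Uxt.
move: oU; rewrite openE => /(_ _ Uxt) /nbhs_ballP[e /= e0 eU].
have [i [ix ie]] := rat_ball_mx_basis x e0.
have [j [jt je]] := rat_ball_basis t e0.
by exists i, j; split=> // -[y s] [/ie ? /je ?]; exact: eU.
Qed.

Lemma open_measurable_rV_rV m n (U : set ('rV[R]_m * 'rV[R]_n)) :
  open U -> measurable U.
Proof.
move=> oU; apply: (measurable_countable_rectangles
  (@measurable_rat_ball_mx m) (@measurable_rat_ball_mx n)) => -[x t] Uxt.
move: oU; rewrite openE => /(_ _ Uxt) /nbhs_ballP[e /= e0 eU].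
have [i [ix ie]] := rat_ball_mx_basis x e0.
have [j [jt je]] := rat_ball_mx_basis t e0.
by exists i, j; split=> // -[y s] [/ie ? /je ?]; exact: eU.
Qed.

Lemma continuous_measurable_rV_R n (f : 'rV[R]_n * R -> R) : continuous f ->
  measurable_fun setT (f : 'rV[R]_n * measurableTypeR R -> R).
Proof.
move=> /continuousP cf; apply: (measurability _ (RGenOpens.measurableE R)).
move=> _ [_ [a [b ->] <-]]; rewrite setTI; apply: open_measurable_rV_R.
exact/cf/interval_open.
Qed.

Lemma continuous_measurable_mx m n (f : 'M[R]_(m, n) -> R) : continuous f ->
  measurable_fun setT f.
Proof.
move=> /continuousP cf; apply: (measurability _ (RGenOpens.measurableE R)).
move=> _ [_ [a [b ->] <-]]; rewrite setTI; apply: open_measurable_mx.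
exact/cf/interval_open.
Qed.

Lemma continuous_measurable_mx_mx m n p q (f : 'M[R]_(m, n) -> 'M[R]_(p, q)) :
  continuous f -> measurable_fun setT f.
Proof.
move=> /continuousP cf; apply: (@measurability _ _ _ _ _ _ (open : set (set 'M[R]_(p, q)))) => //.
by move=> _ [A oA <-]; rewrite setTI; apply: open_measurable_mx; exact: cf.
Qed.

Lemma measurable_addrV n :
  measurable_fun setT (fun p : 'rV[R]_n * 'rV[R]_n => p.1 + p.2).
Proof.
apply: (@measurability _ _ _ _ _ _ (open : set (set 'rV[R]_n))) => //.
move=> _ [A oA <-]; rewrite setTI; apply: open_measurable_rV_rV.
have /continuousP := @add_continuous 'rV[R]_n; exact.
Qed.

Lemma measurable_opprV n : measurable_fun setT (fun x : 'rV[R]_n => - x).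
Proof. by apply: continuous_measurable_mx_mx; exact: opp_continuous. Qed.

Lemma measurable_coordrV n (i : 'I_n) : measurable_fun setT (fun x : 'rV[R]_n => x ord0 i).
Proof. by apply: continuous_measurable_mx; exact: coord_continuous. Qed.

Lemma measurable_translaterV n (a : 'rV[R]_n) : measurable_fun setT (fun x : 'rV[R]_n => x + a).
Proof.
apply: continuous_measurable_mx_mx => x.
by apply: (@continuousD R 'rV[R]_n 'rV[R]_n id (cst a) x); [exact: cvg_id|exact: cst_continuous].
Qed.

End borel_product.

(** * Translation invariance of Lebesgue measure on R^n *)

Section translation_invariance.
Context {R : realType}.
Local Open Scope ereal_scope.

(** By uniqueness of the measure that gives half-open intervals their length: a translation
    preserves these lengths. *)
Lemma lebesgue_measure_translate (a : R) (A : set (measurableTypeR R)) :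
  measurable A -> lebesgue_measure ((fun x : R => (x + a)%R) @^-1` A) = lebesgue_measure A.
Proof.
have mT : measurable_fun setT (fun x : measurableTypeR R => (x + a)%R : measurableTypeR R).
  by apply: measurable_funD.
pose f : {mfun measurableTypeR R >-> measurableTypeR R} :=
  HB.pack (fun x : measurableTypeR R => (x + a)%R : measurableTypeR R)
    (isMeasurableFun.Build _ _ _ _ _ mT).
move=> mA; apply/esym.
apply: (@lebesgue_measure_unique R (pushforward lebesgue_measure f)) => //= _ [[b c]] _ <-.
rewrite /pushforward (_ : _ @^-1` _ = `](b - a)%R, (c - a)%R]%classic); last first.
  by apply/seteqP; split=> x /=; rewrite !in_itv/= ltrBlDr lerBrDr.
rewrite !lebesgue_measure_itv/= !lte_fin ltrD2r; case: ifP => // _.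
by rewrite -!EFinB; congr (_%:E); lra.
Qed.

(** Induction on the dimension, following the construction of the measure: [a] splits into a shift
    [a0] of the first coordinate and a shift [a'] of the remaining ones. *)
Lemma lebesgue_rV_translate n (a : 'rV[R]_n) (A : set 'rV[R]_n) :
  measurable A -> lebesgue_rV n ((fun x => (x + a)%R) @^-1` A) = lebesgue_rV n A.
Proof.
elim: n a A => [|n IH] a A mA.
  by congr lebesgue_rV; apply/seteqP; split=> x /=; rewrite (thinmx0 (x + a)%R) (thinmx0 x).
pose a0 := a ord0 (lshift n (ord0 : 'I_1)) : R.
pose a' : 'rV[R]_n := rsubmx (a : 'rV_(1 + n)).
pose B := @cons_rV R n @^-1` A.
have mB : measurable B.
  by rewrite -[X in measurable X]setTI; exact: measurable_cons_rV.
have E x v : (cons_rV (x, v) + a)%R = cons_rV ((x + a0)%R, (v + a')%R).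
  transitivity (row_mx x%:M v + row_mx (lsubmx (a : 'rV_(1 + n))) a' : 'rV_(1 + n))%R.
    by rewrite hsubmxK.
  rewrite add_row_mx; apply: (congr2 (@row_mx R 1 1 n)) => //=.
  by apply/matrixP => i j; rewrite !ord1 !mxE eqxx !mulr1n.
rewrite /= /pushforward /=.
(* The product measure integrates the measures of the sections. The induction hypothesis removes
   [a'] from each section, and the one-dimensional case then removes [a0]. *)
transitivity (\int[lebesgue_measure]_x
    ((fun x => lebesgue_rV n (xsection B x)) \o (fun x : R => (x + a0)%R)) x).
  apply: eq_integral => x _ /=; rewrite -[RHS](IH a'); last exact: measurable_xsection.
  congr lebesgue_rV; apply/seteqP; split=> v /=; rewrite /xsection/= !inE.
    by rewrite /B/= E.
  by rewrite /B/= E.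
have mT : measurable_fun setT (fun x : measurableTypeR R => (x + a0)%R : measurableTypeR R).
  by apply: measurable_funD.
rewrite -(@ge0_integral_pushforward _ _ _ _ _ _ mT _ setT)//; last first.
  exact: measurable_fun_xsection.
apply: eq_measure_integral => C mC _; exact: lebesgue_measure_translate.
Qed.

Lemma ge0_integral_translate n (a : 'rV[R]_n) (f : 'rV[R]_n -> \bar R) :
  measurable_fun setT f -> (forall x, 0 <= f x) ->
  \int[lebesgue_rV n]_x f (x + a)%R = \int[lebesgue_rV n]_x f x.
Proof.
move=> mf f0.
rewrite -(@ge0_integral_pushforward _ _ _ _ _ _ (measurable_translaterV a) _ setT)//.
apply: eq_measure_integral; first exact: measurable_translaterV.
by move=> mf' C mC _; exact: lebesgue_rV_translate.
Qed.

Lemma integral_translate n (a : 'rV[R]_n) (f : 'rV[R]_n -> \bar R) :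
  measurable_fun setT f ->
  \int[lebesgue_rV n]_x f (x + a)%R = \int[lebesgue_rV n]_x f x.
Proof.
move=> mf; rewrite integralE [RHS]integralE; congr (_ - _).
  rewrite -[RHS](ge0_integral_translate a)//; last exact: measurable_funepos.
  by apply: eq_integral => x _; rewrite !funeposE.
rewrite -[RHS](ge0_integral_translate a)//; last exact: measurable_funeneg.
by apply: eq_integral => x _; rewrite !funenegE.
Qed.

End translation_invariance.

(** * Restricted measures and measurability of partial integrals *)

Section integration.
Local Open Scope ereal_scope.
Context d (T : measurableType d) (R : realType).

(** The complement of [D] is null for the restricted measure, and the two measures agree inside [D].
    It turns integrals over the punctured space into integrals over the whole space, to which
    Fubini's theorem applies. *)
Lemma integral_mrestr (mu : {measure set T -> \bar R}) (D : set T) (mD : measurable D)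
    (f : T -> \bar R) : measurable_fun setT f ->
  \int[mrestr mu mD]_x f x = \int[mu]_(x in D) f x.
Proof.
move=> mf.
have ge0 (g : T -> \bar R) : measurable_fun setT g -> (forall x, 0 <= g x) ->
    \int[mrestr mu mD]_x g x = \int[mu]_(x in D) g x.
  move=> mg g0.
  rewrite [LHS](@ge0_negligible_integral _ _ _ _ _ (~` D))//; last 2 first.
    exact: measurableC.
    by rewrite /= /mrestr setICl measure0.
  rewrite setDE setCK setTI; apply: eq_measure_integral => A mA AD.
  by rewrite /mrestr; congr (mu _); exact/setIidl.
rewrite [LHS]integralE [RHS]integralE !ge0//; [exact: measurable_funeneg|exact: measurable_funepos].
Qed.

(** Tonelli's theorem covers the positive and the negative part, and the integral is by definition
    their difference. *)
Lemma measurable_fun_integral2 d' (S : measurableType d')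
    (m : {sigma_finite_measure set T -> \bar R}) (f : S * T -> \bar R) :
  measurable_fun setT f -> measurable_fun setT (fun x => \int[m]_y f (x, y)).
Proof.
move=> mf.
rewrite (_ : (fun _ => _) = fun x => \int[m]_y f^\+ (x, y) - \int[m]_y f^\- (x, y)).
  apply: emeasurable_funB; apply: measurable_fun_fubini_tonelli_F => //;
  [exact: measurable_funepos|exact: measurable_funeneg].
apply/funext => x; rewrite integralE; congr (_ - _).
  by apply: eq_integral => y _; rewrite !funeposE.
by apply: eq_integral => y _; rewrite !funenegE.
Qed.

End integration.

(** * Directional derivatives and the mean value theorem on a line *)

Section calculus.
Context {R : realType}.

Lemma smooth_continuous (V : normedModType R) (f : V -> R) : smooth f -> continuous f.
Proof. by move=> /(_ [::])[]. Qed.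

Lemma smooth_derivable (V : normedModType R) (f : V -> R) x v : smooth f -> derivable f x v.
Proof. by move=> /(_ [::])[_]; exact. Qed.

Lemma smooth_derive (V : normedModType R) (f : V -> R) v : smooth f -> smooth ('D_v f).
Proof.
move=> sf vs; have -> : iter_derive vs ('D_v f) = iter_derive (rcons vs v) f.
  by rewrite /iter_derive foldr_rcons.
exact: sf.
Qed.

(** The one-variable theorem for [s |-> f (s *: v + a)], whose difference quotients are those of [f]
    in direction [v]. The increment [b] may have either sign, hence the bound on [|c|]. *)
Lemma mvt_line (V : normedModType R) (f : V -> R) (a v : V) :
  (forall x, derivable f x v) ->
  forall b : R, exists2 c, `|c| <= `|b| &
    f (b *: v + a) - f a = b * 'D_v f (c *: v + a).
Proof.
move=> df; pose g s := f (s *: v + a).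
have E s : (fun h : R => h^-1 *: (g (h *: 1 + s) - g s)) =
    (fun h => h^-1 *: (f (h *: v + (s *: v + a)) - f (s *: v + a))).
  by apply/funext => h; rewrite /g scaler1 scalerDl addrA.
have dg s : is_derive s (1 : R) g ('D_v f (s *: v + a)).
  apply: DeriveDef; last by rewrite /derive E.
  by have := df (s *: v + a); rewrite /derivable E.
have cg : continuous g.
  move=> s; apply: differentiable_continuous.
  by apply/derivable1_diffP; have [] := dg s.
have g0 : g 0 = f a by rewrite /g scale0r add0r.
move=> b; have [b0|b0] := leP 0 b.
  have [c cb E2] := MVT_segment b0 (fun s _ => dg s) (continuous_subspaceT cg).
  exists c; last by move: E2; rewrite subr0 g0 mulrC.
  by move: cb; rewrite in_itv/= => /andP[c0 cb]; rewrite !ger0_norm.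
have [c cb E2] := MVT_segment (ltW b0) (fun s _ => dg s) (continuous_subspaceT cg).
exists c; last first.
  by move/eqP: E2; rewrite sub0r g0 mulrN -eqr_oppLR opprB => /eqP; rewrite mulrC.
by move: cb; rewrite in_itv/= => /andP[bc c0]; rewrite !ler0_norm ?lerN2 // ltW.
Qed.

(** A derivative depends only on values nearby. This carries the vanishing of a test function off
    its support over to its derivatives. *)
Lemma derive_eq0_open (V : normedModType R) (f : V -> R) (O : set V) v : open O ->
  {in O, f =1 cst 0} -> {in O, 'D_v f =1 cst 0}.
Proof.
move=> oO fO x /set_mem Ox.
have f0 : \forall y \near x, f y = cst 0 y.
  have xO : nbhs x O by exact: open_nbhs_nbhs.
  by apply: (filterS _ xO) => y Oy; rewrite fO// inE.
by rewrite (near_eq_derive v f0) derive_cst.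
Qed.

End calculus.

(** * Space and time derivatives on R^N x R *)

Section spacetime.
Context {R : realType} {N : nat}.
Implicit Types (f : 'rV[R]_N * R -> R) (x z : 'rV[R]_N) (t : R).

Definition space_dir (i : 'I_N) : 'rV[R]_N * R := (delta_mx ord0 i, 0).

(** The difference quotients coincide. The gradient of a slice thus becomes a directional derivative
    in space-time, for which [smooth] gives continuity jointly in x and t. *)
Lemma gradient_slice f x t i :
  gradient (slice f t) x ord0 i = 'D_(space_dir i) f (x, t).
Proof.
rewrite mxE /derive.
have -> : (fun h => h^-1 *: ((slice f t \o shift x) (h *: delta_mx ord0 i) - slice f t x)) =
    (fun h => h^-1 *: ((f \o shift (x, t)) (h *: space_dir i) - f (x, t))).
  apply/funext => h; rewrite /slice/=; congr (_ *: (f (_, _) - _)).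
  by rewrite /= scaler0 add0r.
by [].
Qed.

Lemma dt_derive f p : dt f p = 'D_((0, 1) : 'rV[R]_N * R) f p.
Proof.
case: p => x t; rewrite /dt derive1E /derive /=.
have -> : (fun h => h^-1 *: (((fun s => f (x, s)) \o shift t) (h *: 1) - f (x, t))) =
    (fun h => h^-1 *: ((f \o shift (x, t)) (h *: (0, 1)) - f (x, t))).
  apply/funext => h /=; congr (_ *: (f (_, _) - _)).
  by rewrite /= scaler0 add0r.
by [].
Qed.

(** Walk from x to x + z by changing one coordinate at a time and apply [mvt_line] on each leg. Only
    directional derivatives enter, which is what [smooth] provides. *)
Lemma mvt_coordinates f x z t : (forall i p, derivable f p (space_dir i)) ->
  exists2 xi : 'I_N -> 'rV[R]_N,
    (forall i j, `|(xi i - x) ord0 j| <= `|z ord0 j|) &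
    f (x + z, t) - f (x, t) = \sum_i z ord0 i * 'D_(space_dir i) f (xi i, t).
Proof.
move=> df.
(* The corners of the path: [p k] has its first k coordinates already moved, so [p 0] is x and [p N]
   is x + z. *)
pose p (k : nat) : 'rV[R]_N := x + \row_(j < N) (if (j < k)%N then z ord0 j else 0).
have pS (i : 'I_N) : (p i.+1, t) = z ord0 i *: space_dir i + (p i, t).
  transitivity (z ord0 i *: delta_mx ord0 i + p i, z ord0 i *: 0 + t); last by [].
  rewrite scaler0 add0r; congr (_, _).
  apply/rowP => j; rewrite !mxE ord1 eqxx/= ltnS leq_eqVlt -val_eqE/=.
  by case: ltngtP => [//|//|/val_inj ->]; rewrite /= ?mulr0 ?mulr1 ?add0r// addr0 addrC.
have /choice[c hc] : forall i : 'I_N, exists c, `|c| <= `|z ord0 i| /\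
    f (p i.+1, t) - f (p i, t) =
    z ord0 i * 'D_(space_dir i) f (c *: space_dir i + (p i, t)).
  move=> i; have [c c1 c2] := @mvt_line _ _ f (p i, t) (space_dir i) (df i) (z ord0 i).
  by exists c; split => //; rewrite pS.
exists (fun i => c i *: delta_mx ord0 i + p i).
  move=> i j; rewrite !mxE ord1 eqxx/=.
  rewrite addrCA addrAC subrr add0r.
  have [<-|ij] := eqVneq i j; first by rewrite mulr1 ltnn addr0; have [] := hc i.
  by rewrite mulr0 add0r; case: ifP; rewrite ?normr0.
have -> : x + z = p N.
  by apply/rowP => j; rewrite !mxE ltn_ord.
have -> : (x, t) = (p 0%N, t).
  by congr (_, _); apply/rowP => j; rewrite !mxE ltn0 addr0.
rewrite -(telescope_sumr (fun k => f (p k, t)) (leq0n N)) big_mkord.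
apply: eq_bigr => i _; have [_ ->] := hc i.
have -> // : c i *: space_dir i + (p i, t) = (c i *: delta_mx ord0 i + p i, t).
transitivity (c i *: delta_mx ord0 i + p i, c i *: 0 + t); first by [].
by rewrite scaler0 add0r.
Qed.

End spacetime.

(** * Bounds on test functions, uniform in time *)

Section test_function_bounds.
Context {R : realType} {N : nat}.
Implicit Types (f : 'rV[R]_N -> R) (psi : 'rV[R]_N * R -> R) (x z : 'rV[R]_N).

(* Both parts of the Levy condition at once: it amounts to [kappa] being
   integrable on the punctured space. *)
Definition kappa z : R := Num.min 1 (enorm z ^+ 2).

(** The integrand of [levy_operator], written tau in the outline. *)
Definition taylor f x z : R :=
  f (x + z) - f x - dotp z (gradient f x) * \1_(unit_ball N) z.

(** The ball is taken in the sup norm, so this is an open cube of half-side k + 1. *)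
Definition cube (k : nat) : set 'rV[R]_N := ball 0 k.+1%:R.

Lemma cubeP k x : cube k x <-> forall j, `|x ord0 j| < k.+1%:R.
Proof.
split=> [[_ H] j|H]; first by have := H ord0 j; rewrite /ball/= mxE sub0r normrN.
by split=> // i j; rewrite ord1 /ball/= mxE sub0r normrN.
Qed.

Lemma measurable_cube k : measurable (cube k).
Proof. by apply: open_measurable_mx; exact: ball_open. Qed.

Lemma enorm_ge0 z : 0 <= enorm z. Proof. exact: sqrtr_ge0. Qed.

Lemma coord_le_enorm z i : `|z ord0 i| <= enorm z.
Proof.
rewrite -sqrtr_sqr ler_wsqrtr// /dotp (bigD1 i)//= -expr2 lerDl.
by apply: sumr_ge0 => j _; rewrite -expr2 sqr_ge0.
Qed.

Lemma kappa_ge0 z : 0 <= kappa z.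
Proof. by rewrite le_min ler01 sqr_ge0. Qed.

Lemma kappa_le1 z : enorm z <= 1 -> kappa z = enorm z ^+ 2.
Proof. by move=> z1; rewrite /kappa min_r// expr_le1// enorm_ge0. Qed.

Lemma kappa_gt1 z : 1 < enorm z -> kappa z = 1.
Proof. by move=> z1; rewrite /kappa min_l// expr_ge1// ltW// (lt_trans _ z1). Qed.

Lemma measurable_enorm : measurable_fun setT (@enorm R N).
Proof.
have mdot : measurable_fun setT (fun z : 'rV[R]_N => dotp z z).
  apply: (@measurable_sum _ _ _ _ _ (index_enum 'I_N)
    (fun i (z : 'rV[R]_N) => z ord0 i * z ord0 i)) => i.
  by apply: measurable_funM; exact: measurable_coordrV.
exact: measurableT_comp (continuous_measurable_fun (@sqrt_continuous R)) mdot.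
Qed.

Lemma measurable_unit_ball : measurable (@unit_ball R N).
Proof.
have -> : @unit_ball R N = @enorm R N @^-1` `]-oo, 1%R]%classic.
  by apply/seteqP; split=> z /=; rewrite in_itv.
by rewrite -[X in measurable X]setTI; apply: measurable_enorm.
Qed.

Lemma measurable_kappa : measurable_fun setT kappa.
Proof.
by apply: measurable_minr => //; apply: measurable_funX; exact: measurable_enorm.
Qed.

Lemma dotp_le_enorm z (g : 'rV[R]_N) (M : R) : (forall i, `|g ord0 i| <= M) ->
  `|dotp z g| <= N%:R * M * enorm z.
Proof.
move=> gM; apply: (le_trans (ler_norm_sum _ _ _)).
apply: (@le_trans _ _ (\sum_(i < N) enorm z * M)).
  by apply: ler_sum => i _; rewrite normrM ler_pM// coord_le_enorm.
by rewrite sumr_const card_ord -[X in X <= _]mulr_natl mulrA mulrAC.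
Qed.

Section strip.
Variables (T : R) (K : set ('rV[R]_N * R)).
Hypothesis cK : compact K.

(** A test function is prescribed to vanish off [K] only for times in [0, T). Restricting to the
    open time interval gives an open set, on which all its derivatives vanish too. *)
Definition strip_off : set ('rV[R]_N * R) := [set p | 0 < p.2 < T /\ ~ K p].

Lemma open_strip_off : open strip_off.
Proof.
have -> : strip_off = snd @^-1` `]0, T[%classic `&` ~` K.
  by apply/seteqP; split=> p /=; rewrite in_itv.
apply: openI; last by apply: closed_openC; apply: compact_closed.
apply: open_comp; last exact: interval_open.
by move=> p _; exact: cvg_snd.
Qed.

Lemma strip_bounded psi : continuous psi -> {in strip_off, psi =1 cst 0} ->
  exists2 M : R, 0 <= M & forall p, 0 < p.2 < T -> `|psi p| <= M.
Proof.
move=> cpsi psi0.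
have /compact_bounded /ex_strict_bound_gt0[M M0 psiM] : compact (psi @` K).
  by apply: continuous_compact => //; exact: continuous_subspaceT.
exists M; first exact: ltW.
move=> p p2; have [Kp|nKp] := pselect (K p); first by rewrite ltW// psiM//; exists p.
by rewrite psi0 ?normr0 ?ltW// inE.
Qed.

End strip.

(** The four bounds control, in this order, the time term, the gradient term W, the Levy integrand,
    and the energy of psi. The last two carry an indicator at each end of the jump, since psi may be
    nonzero at x or at x + z. *)
Lemma test_function_bounds T psi : test_function T psi ->
  exists k (C : R), 0 <= C /\ forall t, 0 < t < T ->
  [/\ forall x, `|dt psi (x, t)| <= C * \1_(cube k) x,
      forall x z, `|dotp z (gradient (slice psi t) x)| <= C * enorm z * \1_(cube k) x,
      forall x z, `|taylor (slice psi t) x z| <=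
        C * kappa z * (\1_(cube k) x + \1_(cube k) (x + z)) &
      forall x z, (slice psi t (x + z) - slice psi t x) ^+ 2 <=
        C * kappa z * (\1_(cube k) x + \1_(cube k) (x + z))].
Proof.
move=> [spsi [K [cK Ksub psiK]]].
pose O := strip_off T K; have oO : open O := open_strip_off cK.
have psi0 : {in O, psi =1 cst 0}.
  move=> p /set_mem[/andP[p0 pT] nKp]; apply: psiK => //.
  by rewrite ltW.
have sD v : smooth ('D_v psi) by exact: smooth_derive.
have sDD v w : smooth ('D_w ('D_v psi)) by apply: (smooth_derive (f := 'D_v psi)); exact: sD.
have D0 v : {in O, 'D_v psi =1 cst 0} by exact: derive_eq0_open.
have DD0 v w : {in O, 'D_w ('D_v psi) =1 cst 0} by exact: derive_eq0_open.
have bnd (f : 'rV[R]_N * R -> R) : smooth f -> {in O, f =1 cst 0} ->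
    exists2 M : R, 0 <= M & forall p, 0 < p.2 < T -> `|f p| <= M.
  by move=> sf f0; apply: (@strip_bounded T K) => //; exact: smooth_continuous.
have [M0 M0ge hM0] := bnd _ spsi psi0.
have [Mt Mtge hMt] := bnd _ (sD (0, 1)) (D0 (0, 1)).
have /choice[M1 hM1] : forall i, exists M : R, 0 <= M /\
    forall p, 0 < p.2 < T -> `|'D_(space_dir i) psi p| <= M.
  by move=> i; have [M] := bnd _ (sD (space_dir i)) (D0 _); exists M.
have /choice[M2 hM2] : forall ij : 'I_N * 'I_N, exists M : R, 0 <= M /\
    forall p, 0 < p.2 < T -> `|'D_(space_dir ij.2) ('D_(space_dir ij.1) psi) p| <= M.
  by move=> ij; have [M] := bnd _ (sDD (space_dir ij.1) (space_dir ij.2)) (DD0 _ _); exists M.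
(* A common bound for psi, its time derivative and its space derivatives of orders one and two. *)
pose M := M0 + Mt + \sum_i M1 i + \sum_ij M2 ij.
have S1ge : 0 <= \sum_i M1 i by apply: sumr_ge0 => i _; have [] := hM1 i.
have S2ge : 0 <= \sum_ij M2 ij by apply: sumr_ge0 => i _; have [] := hM2 i.
have M1le i : M1 i <= \sum_i M1 i.
  by rewrite (bigD1 i)//= lerDl; apply: sumr_ge0 => j _; have [] := hM1 j.
have M2le i : M2 i <= \sum_i M2 i.
  by rewrite (bigD1 i)//= lerDl; apply: sumr_ge0 => j _; have [] := hM2 j.
have Mge : 0 <= M by rewrite /M !addr_ge0.
have {}hM0 p : 0 < p.2 < T -> `|psi p| <= M.
  by move=> /hM0 /le_trans; apply; rewrite /M; lra.
have {}hMt p : 0 < p.2 < T -> `|'D_((0, 1) : 'rV[R]_N * R) psi p| <= M.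
  by move=> /hMt /le_trans; apply; rewrite /M; lra.
have {}hM1 i p : 0 < p.2 < T -> `|'D_(space_dir i) psi p| <= M.
  by move=> /(proj2 (hM1 i)) /le_trans; apply; have := M1le i; rewrite /M; lra.
have {}hM2 i j p : 0 < p.2 < T -> `|'D_(space_dir j) ('D_(space_dir i) psi) p| <= M.
  by move=> /(proj2 (hM2 (i, j))) /le_trans; apply; have := M2le (i, j); rewrite /M; lra.
(* The support stays within half-side k while [cube k] has half-side k + 1. This margin of one
   ensures that a jump with |z| <= 1 from outside [cube k] misses the support. *)
have [k Kk] : exists k : nat, forall p, K p -> forall j, `|p.1 ord0 j| < k%:R.
  have [r r0 Kr] := ex_strict_bound_gt0 (compact_bounded cK).
  exists (Num.truncn r).+1 => p /Kr pr j; apply: (lt_trans _ (truncnS_gt r)).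
  have : ball (0 : 'rV[R]_N, 0 : R) r p.
    by rewrite -ball_normE; change (`|0 - p| < r); rewrite sub0r normrN.
  by move=> [[_ /(_ ord0 j) + ] _]; rewrite /ball/= mxE sub0r normrN.
(* Stated for every y in the coordinate box spanned by z around x, so that it applies to x + z and
   also to the intermediate points of [mvt_coordinates]. *)
have lip (f : 'rV[R]_N * R -> R) (A : R) : smooth f -> 0 <= A ->
    (forall i p, 0 < p.2 < T -> `|'D_(space_dir i) f p| <= A) ->
    forall t x y z, 0 < t < T -> (forall j, `|(y - x) ord0 j| <= `|z ord0 j|) ->
    `|f (y, t) - f (x, t)| <= N%:R * A * enorm z.
  move=> sf A0 fA t x y z tT yxz.
  have [xi _] := @mvt_coordinates _ _ f x (y - x) t (fun i p => smooth_derivable sf).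
  rewrite addrCA subrr addr0 => ->.
  apply: (le_trans (ler_norm_sum _ _ _)).
  apply: (@le_trans _ _ (\sum_(i < N) enorm z * A)).
    apply: ler_sum => i _; rewrite normrM ler_pM//; last exact: fA.
    by rewrite (le_trans (yxz i))// coord_le_enorm.
  by rewrite sumr_const card_ord -[X in X <= _]mulr_natl mulrA mulrAC.
(* The summands dominate in turn the constants of the time derivative and of tau for |z| > 1, of the
   gradient, of tau for |z| <= 1, and of the squared difference for |z| <= 1 and for |z| > 1. *)
pose C := M + N%:R * M + N%:R * (N%:R * M) + (N%:R * M) ^+ 2 + 4 * M ^+ 2.
have NM0 : 0 <= N%:R * M by rewrite mulr_ge0.
have NNM0 : 0 <= N%:R * (N%:R * M) by rewrite mulr_ge0.
have NM2 : 0 <= (N%:R * M) ^+ 2 by rewrite sqr_ge0.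
have MM : 0 <= M ^+ 2 by rewrite sqr_ge0.
have [[C0 CM CNM] [CNNM CNM2 CMM]] : [/\ 0 <= C, M <= C & N%:R * M <= C] /\
    [/\ N%:R * (N%:R * M) <= C, (N%:R * M) ^+ 2 <= C & 2 * M ^+ 2 <= C].
  by move: Mge NM0 NNM0 NM2 MM; rewrite /C; clear; split; split; lra.
exists k, C; split=> // t tT.
have off x : ~ cube k x -> O (x, t).
  move=> nx; split => // Kx; apply: nx; apply/cubeP => j.
  by apply: (lt_trans (Kk _ Kx j)); rewrite ltr_nat.
have off1 x z : ~ cube k x -> enorm z <= 1 -> O (x + z, t).
  move=> nx z1; split => // Kx; apply: nx; apply/cubeP => j.
  have := Kk _ Kx j; rewrite /= mxE => H.
  have -> : x ord0 j = (x ord0 j + z ord0 j) - z ord0 j by rewrite addrK.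
  rewrite (le_lt_trans (ler_normB _ _))// -natr1 ltr_leD//.
  by rewrite (le_trans (coord_le_enorm _ _)).
have in1 x : cube k x -> \1_(cube k) x = 1 :> R by move=> xk; rewrite indicE mem_set.
have in0 x : ~ cube k x -> \1_(cube k) x = 0 :> R by move=> xk; rewrite indicE memNset.
have i01 x : 0 <= \1_(cube k) x :> R by rewrite indicE; case: (_ \in _).
have psile x : `|psi (x, t)| <= M * \1_(cube k) x.
  have [xk|xk] := pselect (cube k x); first by rewrite in1// mulr1 hM0.
  by rewrite psi0 ?normr0 ?mulr_ge0// inE; exact: off.
have gle x z : `|dotp z (gradient (slice psi t) x)| <= N%:R * M * enorm z * \1_(cube k) x.
  have [xk|xk] := pselect (cube k x).
    rewrite in1// mulr1; apply: dotp_le_enorm => i.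
    by rewrite gradient_slice hM1.
  rewrite in0// mulr0 /dotp big1 ?normr0// => i _.
  by rewrite gradient_slice D0 ?mulr0// inE; exact: off.
split.
- move=> x; rewrite dt_derive.
  have [xk|xk] := pselect (cube k x).
    by rewrite in1// mulr1 (le_trans (hMt _ _)).
  by rewrite D0 ?normr0 ?mulr_ge0// inE; exact: off.
- move=> x z; apply: (le_trans (gle x z)).
  by rewrite ler_wpM2r// ler_wpM2r ?enorm_ge0//.
(* For |z| > 1 the gradient term is absent and the two values of psi are bounded separately. *)
- move=> x z; have [z1|z1] := leP (enorm z) 1; last first.
    rewrite /taylor indicE memNset ?mulr0 ?subr0; last by apply/negP; rewrite -ltNge.
    rewrite kappa_gt1// mulr1 (le_trans (ler_normB _ _))//.
    rewrite [_ + \1_ _ _]addrC mulrDr lerD//; [apply: (le_trans (psile (x + z)))|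
      apply: (le_trans (psile x))]; by rewrite ler_wpM2r//.
  rewrite /taylor indicE mem_set// mulr1 kappa_le1//.
  have [xk|xk] := pselect (cube k x); last first.
    have -> : dotp z (gradient (slice psi t) x) = 0.
      by have := gle x z; rewrite in0// mulr0 normr_le0 => /eqP.
    rewrite /slice psi0 ?inE; last exact: off1.
    rewrite psi0 ?inE; last exact: off.
    by rewrite /cst !subrr normr0 mulr_ge0 ?addr_ge0// mulr_ge0// sqr_ge0.
  rewrite in1//; apply: (@le_trans _ _ (C * enorm z ^+ 2 * 1)); last first.
    by rewrite ler_wpM2l ?lerDl// mulr_ge0// sqr_ge0.
  rewrite mulr1.
  (* The Taylor remainder becomes a sum of z_i (D_i psi(xi_i) - D_i psi(x)). Each bracket is of
     order |z| by [lip] and the bound on second derivatives, which gives |z|^2. *)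
  have [xi xiz] := @mvt_coordinates _ _ psi x z t (fun i p => smooth_derivable spsi).
  rewrite /slice => ->; rewrite /dotp -sumrB.
  apply: (le_trans (ler_norm_sum _ _ _)).
  apply: (@le_trans _ _ (\sum_(i < N) enorm z * (N%:R * M * enorm z))).
    apply: ler_sum => i _; rewrite gradient_slice -mulrBr normrM ler_pM//.
      exact: coord_le_enorm.
    exact: (lip _ _ (sD (space_dir i)) Mge (hM2 i) _ _ _ _ tT (xiz i)).
  rewrite sumr_const card_ord -[X in X <= _]mulr_natl.
  rewrite (_ : _ * _ = N%:R * (N%:R * M) * enorm z ^+ 2); last by ring.
  by rewrite ler_wpM2r ?sqr_ge0//.
- move=> x z; rewrite -real_normK ?num_real//.
  have [z1|z1] := leP (enorm z) 1; last first.
    rewrite kappa_gt1// mulr1.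
    apply: (@le_trans _ _ ((M * (\1_(cube k) x + \1_(cube k) (x + z))) ^+ 2)).
      rewrite lerXn2r ?nnegrE ?mulr_ge0 ?addr_ge0//.
      rewrite (le_trans (ler_normB _ _))// mulrDr addrC lerD//; exact: psile.
    rewrite exprMn; set a := \1_(cube k) x; set b := \1_(cube k) (x + z).
    (* The indicators take the values 0 and 1 only, so (a + b)^2 <= 2 (a + b). *)
    apply: (@le_trans _ _ (2 * M ^+ 2 * (a + b))); last first.
      by rewrite ler_wpM2r ?addr_ge0//.
    have -> : 2 * M ^+ 2 * (a + b) = M ^+ 2 * (2 * (a + b)) by ring.
    rewrite ler_wpM2l// /a /b !indicE.
    by do 2 case: (_ \in _) => /=; lra.
  rewrite kappa_le1//.
  have [xk|xk] := pselect (cube k x); last first.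
    rewrite /slice psi0 ?inE; last exact: off1.
    rewrite psi0 ?inE; last exact: off.
    by rewrite /cst subrr normr0 expr0n/= mulr_ge0 ?addr_ge0// mulr_ge0// sqr_ge0.
  rewrite in1//; apply: (@le_trans _ _ (C * enorm z ^+ 2 * 1)); last first.
    by rewrite ler_wpM2l ?lerDl// mulr_ge0// sqr_ge0.
  rewrite mulr1; apply: (@le_trans _ _ ((N%:R * M * enorm z) ^+ 2)).
    rewrite lerXn2r ?nnegrE ?mulr_ge0 ?enorm_ge0//.
    by apply: (lip _ _ spsi) => // j; rewrite addrAC subrr add0r.
  by rewrite exprMn ler_wpM2r ?sqr_ge0//.
Qed.

End test_function_bounds.

(** * The energy identity at a fixed time *)

Section energy_identity.
Context {R : realType} {N : nat}.
Variable nu : {sigma_finite_measure set 'rV[R]_N -> \bar R}.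
Hypothesis nu_even : forall B : set 'rV[R]_N, measurable B ->
  nu ((fun z : 'rV[R]_N => - z) @^-1` B) = nu B.
Hypothesis nu_kappa : (\int[nu]_z (kappa z)%:E < +oo)%E.
Local Open Scope ereal_scope.
Local Notation leb := (lebesgue_rV N).
Implicit Types (F psi : 'rV[R]_N -> R) (x z : 'rV[R]_N).

Lemma ge0_integral_even (f : 'rV[R]_N -> \bar R) :
  measurable_fun setT f -> (forall x, 0 <= f x) ->
  \int[nu]_z f (- z)%R = \int[nu]_z f z.
Proof.
move=> mf f0.
rewrite -(@ge0_integral_pushforward _ _ _ _ _ _ (@measurable_opprV R N) _ setT)//.
apply: eq_measure_integral; first exact: measurable_opprV.
by move=> mo C mC _; exact: nu_even.
Qed.

(** The map S of the outline. It reverses a jump: starting point x and displacement z become x + z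
    and - z. *)
Definition flip (p : 'rV[R]_N * 'rV[R]_N) : 'rV[R]_N * 'rV[R]_N := (p.1 + p.2, - p.2)%R.

Lemma measurable_flip : measurable_fun setT flip.
Proof.
apply: measurable_fun_pair; first exact: measurable_addrV.
by apply: measurableT_comp => //; exact: measurable_opprV.
Qed.

(** With z as the outer variable, translation by z removes the shift in x; evenness of [nu] then
    removes the sign of z. *)
Lemma ge0_integral_flip (h : 'rV[R]_N * 'rV[R]_N -> \bar R) :
  measurable_fun setT h -> (forall p, 0 <= h p) ->
  \int[leb \x nu]_p h (flip p) = \int[leb \x nu]_p h p.
Proof.
move=> mh h0.
have mhf : measurable_fun setT (h \o flip).
  by apply: measurableT_comp => //; exact: measurable_flip.
rewrite (fubini_tonelli2 (m1 := leb) (m2 := nu) h mh h0).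
transitivity (\int[nu]_z fubini_G leb (h \o flip) z).
  exact: (fubini_tonelli2 (m1 := leb) (m2 := nu) (h \o flip) mhf (fun p => h0 _)).
transitivity (\int[nu]_z fubini_G leb h (- z)%R).
  apply: eq_integral => z _; rewrite /fubini_G.
  apply: (ge0_integral_translate z (f := fun x => h (x, - z)%R)) => //.
  by apply: measurableT_comp => //; exact: pair2_measurable.
apply: (ge0_integral_even (f := fubini_G leb h)).
  exact: measurable_fun_fubini_tonelli_G.
by move=> z; exact: integral_ge0.
Qed.

Lemma integral_flip (h : 'rV[R]_N * 'rV[R]_N -> \bar R) :
  measurable_fun setT h ->
  \int[leb \x nu]_p h (flip p) = \int[leb \x nu]_p h p.
Proof.
move=> mh; rewrite [LHS]integralE [RHS]integralE; congr (_ - _).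
  rewrite -[RHS]ge0_integral_flip//; last exact: measurable_funepos.
  by apply: eq_integral => x _; rewrite !funeposE.
rewrite -[RHS]ge0_integral_flip//; last exact: measurable_funeneg.
by apply: eq_integral => x _; rewrite !funenegE.
Qed.

Lemma integrable_flip (h : 'rV[R]_N * 'rV[R]_N -> \bar R) :
  (leb \x nu).-integrable setT h -> (leb \x nu).-integrable setT (h \o flip).
Proof.
move=> /integrableP[mh hoo]; apply/integrableP; split.
  by apply: measurableT_comp => //; exact: measurable_flip.
rewrite (ge0_integral_flip (h := abse \o h)); [exact: hoo| |by move=> p; exact: abse_ge0].
by apply: measurableT_comp.
Qed.

(** [kappa z] times the number of ends of the jump from x to x + z that lie in the cube. *)
Definition cutoff (k : nat) (x z : 'rV[R]_N) : R :=
  (kappa z * (\1_(cube k) x + \1_(cube k) (x + z)))%R.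

(* Up to a constant, [weight k] dominates, uniformly in time, everything that is
   tested against u or phi(u): dt psi, z.D psi / |z| and L(psi). *)
Definition weight (k : nat) (x : 'rV[R]_N) : \bar R :=
  (\1_(cube k) x)%:E + \int[nu]_z (cutoff k x z)%:E.

Lemma cutoff_ge0 k x z : (0 <= cutoff k x z)%R.
Proof. by rewrite /cutoff mulr_ge0 ?kappa_ge0// addr_ge0. Qed.

Lemma measurable_cutoff k : measurable_fun setT (fun p => cutoff k p.1 p.2).
Proof.
apply: measurable_funM.
  by apply: measurableT_comp => //; exact: measurable_kappa.
apply: measurable_funD; apply: measurableT_comp => //.
- by apply: measurable_indic; exact: measurable_cube.
- by apply: measurable_indic; exact: measurable_cube.
- exact: measurable_addrV.
Qed.

Lemma weight_ge0 k x : 0 <= weight k x.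
Proof.
rewrite adde_ge0 ?lee_fin//; apply: integral_ge0 => z _; rewrite lee_fin.
exact: cutoff_ge0.
Qed.

Lemma measurable_integral_cutoff k :
  measurable_fun setT (fun x => \int[nu]_z (cutoff k x z)%:E).
Proof.
apply: (measurable_fun_integral2 nu (f := fun p => (cutoff k p.1 p.2)%:E)).
by apply/measurable_EFinP; exact: measurable_cutoff.
Qed.

Lemma measurable_weight k : measurable_fun setT (weight k).
Proof.
apply: emeasurable_funD; last exact: measurable_integral_cutoff.
by apply/measurable_EFinP; apply: measurable_indic; exact: measurable_cube.
Qed.

Lemma lebesgue_cube_lty k : leb (@cube R N k) < +oo.
Proof. by have [m -> ] := @lebesgue_rV_sigma_finite_measure R N; exact. Qed.

Lemma integral_indic_cube k : \int[leb]_x (\1_(cube k) x)%:E = leb (@cube R N k).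
Proof. by rewrite integral_indic ?setIT//; exact: measurable_cube. Qed.

(** By Tonelli and translation invariance, the integral over x for fixed z is twice the volume of
    the cube times [kappa z], and [kappa] is integrable. *)
Lemma integral_cutoff_lty k : \int[leb]_x \int[nu]_z (cutoff k x z)%:E < +oo.
Proof.
rewrite (fubini_tonelli (m1 := leb) (m2 := nu) (fun p => (cutoff k p.1 p.2)%:E)); last 2 first.
- by apply/measurable_EFinP; exact: measurable_cutoff.
- by move=> p; rewrite lee_fin cutoff_ge0.
rewrite /fubini_G /=.
have mcube : measurable_fun setT (fun x : 'rV[R]_N => (\1_(cube k) x : R)%:E).
  by apply/measurable_EFinP; apply: measurable_indic; exact: measurable_cube.
have E z : \int[leb]_x (cutoff k x z)%:E = (leb (@cube R N k) + leb (@cube R N k)) * (kappa z)%:E.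
  under eq_integral do rewrite /cutoff EFinM EFinD.
  rewrite ge0_integralZl ?lee_fin ?kappa_ge0//; last 2 first.
  - apply: emeasurable_funD => //.
    by apply: (measurableT_comp mcube); exact: measurable_translaterV.
  - by move=> x _; rewrite adde_ge0// lee_fin.
  rewrite muleC; congr (_ * _).
  rewrite ge0_integralD//; last first.
    by apply: (measurableT_comp mcube); exact: measurable_translaterV.
  rewrite (ge0_integral_translate z (f := fun x => (\1_(cube k) x : R)%:E))//.
  by rewrite integral_indic_cube.
under eq_integral do rewrite E.
rewrite ge0_integralZl//; last 3 first.
- by apply/measurable_EFinP; exact: measurable_kappa.
- by move=> z _; rewrite lee_fin kappa_ge0.
- by rewrite adde_ge0.
rewrite lte_mul_pinfty ?adde_ge0// ge0_fin_numE ?adde_ge0// lte_add_pinfty//.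
- exact: lebesgue_cube_lty.
- exact: lebesgue_cube_lty.
Qed.

Lemma integral_weight_lty k : \int[leb]_x weight k x < +oo.
Proof.
rewrite ge0_integralD//; last 3 first.
- by apply/measurable_EFinP; apply: measurable_indic; exact: measurable_cube.
- by move=> x _; apply: integral_ge0 => z _; rewrite lee_fin cutoff_ge0.
- exact: measurable_integral_cutoff.
rewrite lte_add_pinfty ?integral_cutoff_lty// integral_indic_cube.
exact: lebesgue_cube_lty.
Qed.

Lemma kappa_integrable : nu.-integrable setT (fun z => (kappa z)%:E).
Proof.
apply/integrableP; split; first by apply/measurable_EFinP; exact: measurable_kappa.
by under eq_integral do rewrite gee0_abs ?lee_fin ?kappa_ge0//.
Qed.

Section identity.
Variables (F psi : 'rV[R]_N -> R) (k : nat) (C : R).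
Hypotheses (C0 : (0 <= C)%R) (mF : measurable_fun setT F)
  (mpsi : measurable_fun setT psi)
  (mgrad : forall i, measurable_fun setT (fun x => gradient psi x ord0 i)).
Hypothesis grad_bound : forall x z,
  (`|dotp z (gradient psi x)| <= C * enorm z * \1_(cube k) x)%R.
Hypothesis taylor_bound : forall x z, (`|taylor psi x z| <= C * cutoff k x z)%R.
Hypothesis diff_bound : forall x z,
  ((psi (x + z) - psi x) ^+ 2 <= C * cutoff k x z)%R.
Hypothesis F_weight : \int[leb]_x (`|F x|%:E * weight k x) < +oo.
Hypothesis F_energy : \int[leb]_x \int[nu]_z ((F (x + z) - F x) ^+ 2)%:E < +oo.

Let mshift (f : 'rV[R]_N -> R) : measurable_fun setT f ->
  measurable_fun setT (fun p : 'rV[R]_N * 'rV[R]_N => f (p.1 + p.2)%R).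
Proof. by move=> mf; apply: (measurableT_comp mf); exact: measurable_addrV. Qed.

Let mdiff (f : 'rV[R]_N -> R) : measurable_fun setT f ->
  measurable_fun setT (fun p : 'rV[R]_N * 'rV[R]_N => (f (p.1 + p.2) - f p.1)%R).
Proof.
move=> mf; apply: measurable_funB; first exact: mshift.
exact: (measurableT_comp mf).
Qed.

Let unit_cut z : R := \1_(unit_ball N) z.

Let munit_cut : measurable_fun setT unit_cut.
Proof. by apply: measurable_indic; exact: measurable_unit_ball. Qed.

Let ell x z : R := (dotp z (gradient psi x) * unit_cut z)%R.

Let mell : measurable_fun setT (fun p => ell p.1 p.2).
Proof.
apply: measurable_funM; last exact: (measurableT_comp munit_cut).
apply: (@measurable_sum _ _ _ _ _ (index_enum 'I_N)
  (fun i (p : 'rV[R]_N * 'rV[R]_N) => (p.2 ord0 i * gradient psi p.1 ord0 i)%R)) => i.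
apply: measurable_funM; first exact: (measurableT_comp (@measurable_coordrV _ _ i)).
exact: (measurableT_comp (mgrad i)).
Qed.

Let mtaylor : measurable_fun setT (fun p => taylor psi p.1 p.2).
Proof. by apply: measurable_funB; [exact: mdiff|exact: mell]. Qed.

(** The integrand of the energy; [H] below, and [W] further on, are those of the outline. *)
Let G p : R := ((F (p.1 + p.2) - F p.1) * (psi (p.1 + p.2) - psi p.1))%R.
Let H p : R := (F p.1 * taylor psi p.1 p.2)%R.

Let cutoff_integrable :
  (leb \x nu).-integrable setT (fun p => (C * cutoff k p.1 p.2)%:E).
Proof.
apply: (@integrableZl _ _ _ _ _ _ C (fun p => (cutoff k p.1 p.2)%:E)) => //.
apply/integrable12ltyP; first by apply/measurable_EFinP; exact: measurable_cutoff.
under eq_integral => x _ do under eq_integral => z _ do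
  rewrite /= ger0_norm ?cutoff_ge0//.
exact: integral_cutoff_lty.
Qed.

(** From |a b| <= a^2 + b^2: the square of the increment of F is integrable by finite energy, that
    of psi by the cutoff. *)
Let G_integrable : (leb \x nu).-integrable setT (EFin \o G).
Proof.
have iF : (leb \x nu).-integrable setT
    (fun p => ((F (p.1 + p.2) - F p.1) ^+ 2)%:E).
  apply/integrable12ltyP.
    by apply/measurable_EFinP; apply: measurable_funX; exact: mdiff.
  under eq_integral => x _ do under eq_integral => z _ do
    rewrite /= ger0_norm ?sqr_ge0//.
  exact: F_energy.
apply: (le_integrable measurableT _ _ (integrableD measurableT iF cutoff_integrable)).
  by apply/measurable_EFinP; apply: measurable_funM; exact: mdiff.
move=> [x z] _ /=; rewrite lee_fin.
rewrite [leRHS]ger0_norm; last by rewrite addr_ge0 ?sqr_ge0// mulr_ge0// cutoff_ge0.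
rewrite /G /=; apply: (@le_trans _ _
    ((F (x + z) - F x) ^+ 2 + (psi (x + z) - psi x) ^+ 2)%R).
  set a := (F _ - _)%R; set b := (psi _ - _)%R.
  by rewrite ler_norml; apply/andP; split; nra.
by rewrite lerD2l diff_bound.
Qed.

Let mH : measurable_fun setT H.
Proof. by apply: measurable_funM; [exact: (measurableT_comp mF)|exact: mtaylor]. Qed.

(** Integrating |H| <= C |F| [cutoff] over z gives at most C |F| [weight], which is integrable over
    x by assumption. *)
Let H_integrable : (leb \x nu).-integrable setT (EFin \o H).
Proof.
apply/integrable12ltyP; first exact/measurable_EFinP.
apply: (@le_lt_trans _ _ (\int[leb]_x (C%:E * (`|F x|%:E * weight k x)))); last first.
  rewrite ge0_integralZl//.
  - by rewrite lte_mul_pinfty.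
  - apply: emeasurable_funM; last exact: measurable_weight.
    by apply/measurable_EFinP; exact: measurableT_comp.
  - by move=> x _; rewrite mule_ge0 ?weight_ge0.
apply: ge0_le_integral => //.
- by move=> x _; exact: integral_ge0.
- apply: (measurable_fun_integral2 nu (f := fun p => (`|H p|)%:E)).
  by apply/measurable_EFinP; exact: measurableT_comp.
- apply: emeasurable_funM => //; apply: emeasurable_funM; last exact: measurable_weight.
  by apply/measurable_EFinP; exact: measurableT_comp.
move=> x _; apply: (@le_trans _ _ (\int[nu]_z ((C * `|F x|)%:E * (cutoff k x z)%:E))).
  apply: ge0_le_integral => //.
  - apply/measurable_EFinP; apply: measurableT_comp => //.
    exact: (measurable_fun_pair2 x mH).
  - apply: emeasurable_funM => //; apply/measurable_EFinP.
    exact: (measurable_fun_pair2 x (measurable_cutoff k)).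
  - move=> z _; rewrite -EFinM lee_fin /H /= normrM.
    by rewrite [(C * _)%R]mulrC -mulrA ler_wpM2l// taylor_bound.
rewrite ge0_integralZl//; last 3 first.
- by apply/measurable_EFinP; exact: (measurable_fun_pair2 x (measurable_cutoff k)).
- by move=> z _; rewrite lee_fin cutoff_ge0.
- by rewrite lee_fin mulr_ge0.
by rewrite EFinM -muleA lee_wpmul2l ?lee_fin// lee_wpmul2l ?lee_fin// leeDr ?lee_fin.
Qed.

Let W x z : R := (F x * ell x z)%R.

Let rest p : R := (W (p.1 + p.2)%R p.2 - W p.1 p.2)%R.

(** At the flipped point the gradient term changes sign, because the scalar product is odd in z and
    the indicator of the unit ball is even. *)
Let restE p : rest p = (G p + H p + H (flip p))%R.
Proof.
case: p => x z; rewrite /rest /G /H /W /ell /flip /= /taylor addrK.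
have -> : \1_(unit_ball N) (- z)%R = unit_cut z.
  rewrite /unit_cut !indicE; congr (_%:R); congr (nat_of_bool _).
  apply/idP/idP; rewrite !inE /unit_ball /= /enorm /dotp.
    by under eq_bigr do rewrite mxE mulrNN.
  by under [in X in _ -> X]eq_bigr do rewrite mxE mulrNN.
have -> : dotp (- z)%R (gradient psi (x + z)) = (- dotp z (gradient psi (x + z)))%R.
  by rewrite /dotp -sumrN; apply: eq_bigr => i _; rewrite mxE mulNr.
rewrite -/(unit_cut z); ring.
Qed.

(** Near z = 0 each of the two terms of [rest] is controlled only by |z|, while [nu] integrates
    |z|^2. Integrability is therefore read off the other side of [restE]. *)
Let rest_integrable : (leb \x nu).-integrable setT (EFin \o rest).
Proof.
have -> : EFin \o rest = (EFin \o G) \+ ((EFin \o H) \+ ((EFin \o H) \o flip)).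
  by apply/funext => p /=; rewrite restE -addrA.
apply: integrableD => //; apply: integrableD => //.
exact: integrable_flip.
Qed.

(** For a single z, |W| is at most C |z| |F| on the cube, and the indicator summand of [weight]
    controls this. *)
Let W_integrable z : leb.-integrable setT (fun x => (W x z)%:E).
Proof.
have mW : measurable_fun setT (fun x => (W x z)%:E).
  by apply/measurable_EFinP; apply: measurable_funM => //; exact: (measurable_fun_pair1 z mell).
apply/integrableP; split => //.
apply: (@le_lt_trans _ _ (\int[leb]_x ((C * enorm z)%:E * (`|F x|%:E * weight k x)))).
  apply: ge0_le_integral => //.
  - exact: measurableT_comp.
  - apply: emeasurable_funM => //; apply: emeasurable_funM; last exact: measurable_weight.
    by apply/measurable_EFinP; exact: measurableT_comp.
  move=> x _; rewrite /W /ell /= !normrM.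
  apply: (@le_trans _ _ ((C * enorm z)%:E * (`|F x|%:E * (\1_(cube k) x)%:E))).
    rewrite -!EFinM lee_fin [leRHS]mulrCA ler_wpM2l//.
    rewrite -[leRHS]mulr1 ler_pM// ler_norml.
    by rewrite /unit_cut indicE; case: (_ \in _) => /=; apply/andP; split; lra.
  rewrite lee_wpmul2l ?lee_fin ?mulr_ge0 ?enorm_ge0// lee_wpmul2l ?lee_fin//.
  by rewrite leeDl// integral_ge0// => y _; rewrite lee_fin cutoff_ge0.
rewrite ge0_integralZl//.
- by rewrite lte_mul_pinfty// lee_fin mulr_ge0// enorm_ge0.
- apply: emeasurable_funM; last exact: measurable_weight.
  by apply/measurable_EFinP; exact: measurableT_comp.
- by move=> x _; rewrite mule_ge0 ?weight_ge0.
- by rewrite lee_fin mulr_ge0// enorm_ge0.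
Qed.

(** Fubini with the integral over x inside: for each z both terms are integrable over x, and they
    have the same integral by translation. *)
Let integral_rest : \int[leb \x nu]_p (rest p)%:E = 0.
Proof.
rewrite -(integral21_prod_meas1 rest_integrable); apply: integral0_eq => z _.
rewrite /fubini_G /= /rest /=.
have iW := W_integrable z; have mW := measurable_int _ iW.
have iWz : leb.-integrable setT (fun x => (W (x + z)%R z)%:E).
  apply/integrableP; split.
    by apply: (measurableT_comp mW); exact: measurable_translaterV.
  rewrite (ge0_integral_translate z (f := fun x => `|(W x z)%:E|))//.
    by have /integrableP[] := iW.
  exact: measurableT_comp.
under eq_integral do rewrite EFinB.
rewrite integralB// (integral_translate z (f := fun x => (W x z)%:E))// subee//.
exact: integrable_fin_num.
Qed.

Lemma taylor_integrable x : nu.-integrable setT (fun z => (taylor psi x z)%:E).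
Proof.
apply: (le_integrable measurableT (g := fun z => (C * 2)%:E * (kappa z)%:E)).
- by apply/measurable_EFinP; exact: (measurable_fun_pair2 x mtaylor).
- move=> z _; rewrite -EFinM /= lee_fin (le_trans (taylor_bound x z))//.
  rewrite (le_trans _ (ler_norm _))// /cutoff -mulrA ler_wpM2l// mulrC.
  rewrite ler_wpM2r ?kappa_ge0// -[leRHS](_ : 1 + 1 = _)%R; last by [].
  by rewrite lerD// indicE; case: (_ \in _).
- by apply: integrableZl => //; exact: kappa_integrable.
Qed.

(** The Levy operator applied to psi is dominated by [weight], because the integral of [cutoff] over
    z is one of its summands. *)
Lemma Rintegral_taylor_bound x :
  (`|\int[nu]_z taylor psi x z|%R)%:E <= C%:E * weight k x.
Proof.
have it := taylor_integrable x; have mt := measurable_int _ it.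
have mcut : measurable_fun setT (fun z => (cutoff k x z)%:E).
  by apply/measurable_EFinP; exact: (measurable_fun_pair2 x (measurable_cutoff k)).
rewrite EFin_normr_Rintegral//; apply: (le_trans (le_abse_integral _ measurableT mt)).
apply: (@le_trans _ _ (\int[nu]_z (C%:E * (cutoff k x z)%:E))).
  apply: ge0_le_integral => //.
  - exact: measurableT_comp.
  - exact: emeasurable_funM.
  - by move=> z _; rewrite -EFinM lee_fin taylor_bound.
rewrite ge0_integralZl//; last by move=> z _; rewrite lee_fin cutoff_ge0.
by rewrite lee_wpmul2l ?lee_fin// leeDr ?lee_fin.
Qed.

(** The sum of G, H and H after the flip integrates to 0, and the flip preserves the integral, so
    that of G is -2 times that of H. Fubini turns both into iterated integrals. *)
Lemma energy_taylor :
  leb.-integrable setT (fun x => (F x * (\int[nu]_z taylor psi x z)%R)%:E) /\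
  (2^-1)%:E * \int[leb]_x \int[nu]_z ((F (x + z) - F x) * (psi (x + z) - psi x))%:E =
  - \int[leb]_x (F x * (\int[nu]_z taylor psi x z)%R)%:E.
Proof.
have HE x : \int[nu]_z (EFin \o H) (x, z) = (F x * (\int[nu]_z taylor psi x z)%R)%:E.
  rewrite /H /=; under eq_integral do rewrite EFinM.
  rewrite integralZl//; last exact: taylor_integrable.
  rewrite EFinM /Rintegral fineK//.
  by apply: integrable_fin_num => //; exact: taylor_integrable.
have H12 := integral12_prod_meas1 H_integrable.
have iH12 := integrable_fubini_F H_integrable.
rewrite /fubini_F in H12 iH12.
have E : (fun x => \int[nu]_z (EFin \o H) (x, z)) =
  fun x => (F x * (\int[nu]_z taylor psi x z)%R)%:E by exact/funext.
rewrite E in iH12 H12; split => //.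
rewrite H12; have := integral12_prod_meas1 G_integrable; rewrite /fubini_F /G /= => ->.
have := integral_rest.
under eq_integral do rewrite restE !EFinD.
have iHf : (leb \x nu).-integrable setT (EFin \o H \o flip) by exact: integrable_flip.
rewrite integralD//; last by apply: integrableD.
rewrite integralD//.
rewrite (integral_flip (h := EFin \o H))//; last exact/measurable_EFinP.
(* Both integrals are finite, so the extended identity a + b + b = 0 can be solved in the reals. *)
have := integrable_fin_num measurableT H_integrable.
have := integrable_fin_num measurableT G_integrable.
case: (\int[_]_p (EFin \o G) p) => // a _; case: (\int[_]_p (EFin \o H) p) => // b _.
move=> /eqP; rewrite -!EFinD eqe => /eqP ab; congr (_%:E); lra.
Qed.

End identity.

End energy_identity.

(** * From the Levy measure to a sigma-finite measure on the whole space *)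

Section levy_measure_restriction.
Context {R : realType} {N : nat} (mu : {measure set 'rV[R]_N -> \bar R}).
Local Open Scope ereal_scope.

Lemma puncturedE : @punctured R N = ~` [set 0%R].
Proof. by apply/seteqP; split=> z; [move=> /eqP|move=> z0; exact/eqP]. Qed.

Lemma measurable_punctured : measurable (@punctured R N).
Proof.
rewrite puncturedE; apply: open_measurable_mx; apply: closed_openC; apply: accessible_closed_set1.
by apply: hausdorff_accessible; exact: norm_hausdorff.
Qed.

Lemma enorm0 : enorm (0 : 'rV[R]_N) = 0%R.
Proof. by rewrite /enorm /dotp big1 ?sqrtr0// => i _; rewrite mxE mul0r. Qed.

Lemma enorm_gt0 (z : 'rV[R]_N) : z != 0%R -> (0 < enorm z)%R.
Proof.
move=> z0; rewrite lt_neqAle enorm_ge0 andbT eq_sym; apply: contra_neq z0 => z0.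
by apply/rowP => i; apply/eqP; rewrite mxE -normr_le0 -z0 coord_le_enorm.
Qed.

(** Split at the unit sphere: [kappa] is |z|^2 inside and 1 outside, which gives the two integrals
    of the Levy condition. *)
Lemma integral_kappa_punctured : levy_integrable mu ->
  \int[mu]_(z in punctured N) (kappa z)%:E < +oo.
Proof.
rewrite /levy_integrable.
have mP := measurable_punctured; have mB := measurable_unit_ball.
have PE : @punctured R N = (punctured N `&` unit_ball N) `|` ~` unit_ball N.
  apply/seteqP; split=> [z Pz|z [[]//|]].
    by have [|] := pselect (unit_ball N z); [left|right].
  by move=> nz; apply/eqP => z0; apply: nz; rewrite /unit_ball/= z0 enorm0.
rewrite {2}PE ge0_integral_setU//; last 5 first.
- exact: measurableI.
- exact: measurableC.
- by apply/measurable_EFinP; apply: measurable_funTS; exact: measurable_kappa.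
- by move=> z _; rewrite lee_fin kappa_ge0.
- by apply/disj_setPS => z [[_ +] +].
rewrite (eq_integral (fun z => (enorm z ^+ 2)%:E)); last first.
  by move=> z /set_mem[_ ?]; rewrite kappa_le1.
rewrite [X in _ -> _ + X < _](eq_integral (fun=> 1))//.
by move=> z /set_mem /= /negP; rewrite -ltNge => ?; rewrite kappa_gt1.
Qed.

(** [nu] is the restriction of [mu] to the punctured space. It is sigma-finite because [kappa] is
    integrable and positive away from the origin. *)
Lemma levy_sigma_finite : even_measure mu -> levy_integrable mu ->
  exists nu : {sigma_finite_measure set 'rV[R]_N -> \bar R},
  [/\ forall B : set 'rV[R]_N, measurable B ->
        nu ((fun z : 'rV[R]_N => - z)%R @^-1` B) = nu B,
      \int[nu]_z (kappa z)%:E < +oo &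
      forall f, measurable_fun setT f ->
        \int[mu]_(z in punctured N) f z = \int[nu]_z f z].
Proof.
move=> mu_even /integral_kappa_punctured.
have mP := measurable_punctured.
have mk : measurable_fun setT (fun z : 'rV[R]_N => (kappa z)%:E).
  by apply/measurable_EFinP; exact: measurable_kappa.
rewrite -(integral_mrestr mu mP mk) => koo.
have m0 : measurable [set (0%R : 'rV[R]_N)].
  by rewrite -[X in measurable X]setCK -puncturedE; exact: measurableC.
have sf : sigma_finite setT (mrestr mu mP).
  pose A n : set 'rV[R]_N := [set z | (1 <= n%:R * kappa z)%R].
  have mA n : measurable (A n).
    have -> : A n = (fun z => n%:R * kappa z)%R @^-1` `[1%R, +oo[%classic.
      by apply/seteqP; split=> z /=; rewrite in_itv/= andbT.
    rewrite -[X in measurable X]setTI; apply: measurable_funM => //.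
    exact: measurable_kappa.
  (* [kappa] vanishes at the origin, which therefore lies in no [A n]; it is added by hand and has
     measure zero for the restriction. *)
  exists (fun n => A n `|` [set 0%R]).
    apply/seteqP; split => // z _; have [->|z0] := eqVneq z 0%R.
      by exists 0%N => //; right.
    have k0 : (0 < kappa z)%R by rewrite lt_min ltr01 exprn_gt0// enorm_gt0.
    exists (Num.truncn (kappa z)^-1).+1 => //; left.
    by rewrite /A /= -ler_pdivrMr// div1r ltW// truncnS_gt.
  move=> n; split; first exact: measurableU.
  rewrite (@le_lt_trans _ _ (mrestr mu mP (A n) + mrestr mu mP [set 0%R]))//.
    exact: measureU2.
  rewrite [X in _ + X](_ : _ = 0) ?adde0; last first.
    rewrite /mrestr [X in mu X](_ : _ = set0) ?measure0//.
    by rewrite puncturedE setICr.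
  have -> : mrestr mu mP (A n) = \int[mrestr mu mP]_z (\1_(A n) z)%:E.
    by rewrite integral_indic// setIT.
  (* Markov's inequality: the indicator of [A n] is at most n [kappa]. *)
  apply: (@le_lt_trans _ _ (\int[mrestr mu mP]_z ((n%:R)%:E * (kappa z)%:E))).
    apply: ge0_le_integral => //.
    - by apply/measurable_EFinP; exact: measurable_indic.
    - by apply: emeasurable_funM.
    move=> z _; rewrite -EFinM lee_fin indicE.
    by case: (boolP (z \in A n)) => [/set_mem//|_]; rewrite mulr_ge0// kappa_ge0.
  rewrite ge0_integralZl//; last by move=> z _; rewrite lee_fin kappa_ge0.
  by rewrite lte_mul_pinfty.
pose nu : {sigma_finite_measure set 'rV[R]_N -> \bar R} :=
  HB.pack (mrestr mu mP) (Measure_isSigmaFinite.Build _ _ _ (mrestr mu mP) sf).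
exists nu; split => //; last first.
  by move=> f mf; rewrite -(integral_mrestr mu mP mf).
move=> B mB; rewrite /nu /= /mrestr [RHS]mu_even; last 2 first.
- exact: measurableI.
- by move=> z [].
congr (mu _); apply/seteqP; split=> z /=.
  by move=> [Bz z0]; exists (- z)%R; [split => //; rewrite /punctured/= oppr_eq0|rewrite opprK].
by move=> [y [By y0] <-]; split; [rewrite /= opprK|rewrite /punctured/= oppr_eq0].
Qed.

End levy_measure_restriction.

(** * Bounded functions on the cylinder and weighted integrability *)

Section weighted_spacetime.
Context {R : realType} {N : nat} (T : R).
Local Open Scope ereal_scope.
Local Notation spacetime := ('rV[R]_N * measurableTypeR R)%type.
Local Notation leb := (lebesgue_rV N).
Local Notation lam := (@lebesgue_measure R).

Lemma measurable_cylinder : measurable (cylinder T : set spacetime).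
Proof.
have -> : (cylinder T : set spacetime) = setT `*` `]0%R, T[%classic.
  by apply/seteqP; split=> [p pT|p [_]]; rewrite /cylinder/= ?in_itv//=; split.
exact: measurableX.
Qed.

Lemma cylinderF (f : spacetime -> R) p : ~ cylinder T p -> (f \_ (cylinder T))%R p = 0%R.
Proof. by move=> np; rewrite patchE memNset. Qed.

Lemma cylinderT (f : spacetime -> R) p : cylinder T p -> (f \_ (cylinder T))%R p = f p.
Proof. by move=> np; rewrite patchE mem_set. Qed.

Lemma Linfty_cylinder_bounded (u : 'rV[R]_N * R -> R) : Linfty_cylinder T u ->
  exists2 M : R, (0 <= M)%R &
    {ae leb \x lam, forall p, (`|(u \_ (cylinder T)) p| <= M)%R}.
Proof.
rewrite /Linfty_cylinder => /andP[_]; rewrite inE/= /finite_norm.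
(* The norm is defined by cases on whether the whole space has positive measure. If it has none,
   every property holds almost everywhere. *)
rewrite unlock/=; case: ifPn => [mu0|]; last first.
  rewrite -leNgt => mu0 _; exists 0%R => //.
  exists setT; split => //; apply/eqP.
  by rewrite eq_le mu0 measure_ge0.
move=> /ess_supr_bounded[M HM]; exists `|M|%R => //.
by apply: filterS HM => p /le_trans; apply; exact: ler_norm.
Qed.

(** By monotonicity phi(u) lies between phi(-M) and phi(M) wherever |u| <= M. *)
Lemma ae_bounded_comp (phi : R -> R) (u : spacetime -> R) (M : R) :
  {homo phi : x y / (x <= y)%R} ->
  {ae leb \x lam, forall p, (`|(u \_ (cylinder T)) p| <= M)%R} ->
  {ae leb \x lam, forall p,
    (`|((phi \o u) \_ (cylinder T)) p| <= `|phi M| + `|phi (- M)|)%R}.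
Proof.
move=> phi_nd; apply: (@filterS _ _ (ae_filter_ringOfSetsType (leb \x lam))) => p.
have [pT|pT] := pselect (cylinder T p); last by rewrite !cylinderF// normr0 addr_ge0.
rewrite !cylinderT//= ler_norml => /andP[/phi_nd l1 /phi_nd l2].
rewrite ler_norml; apply/andP; split.
  by rewrite (le_trans _ l1)// lerNl (le_trans (ler_norm _))// normrN lerDr.
by rewrite (le_trans l2)// (le_trans (ler_norm _))// lerDl.
Qed.

Section fixed_nu.
Variable nu : {sigma_finite_measure set 'rV[R]_N -> \bar R}.
Hypothesis nu_kappa : \int[nu]_z (kappa z)%:E < +oo.

(** The function is dominated almost everywhere by M [weight] on the time interval (0, T), whose
    integral is M T times that of [weight]. *)
Lemma integrable_weight_spacetime (k : nat) (f : spacetime -> R) (M : R) :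
  (0 < T)%R -> measurable_fun setT f -> (forall p, ~ cylinder T p -> f p = 0%R) ->
  (0 <= M)%R -> {ae leb \x lam, forall p, (`|f p| <= M)%R} ->
  (leb \x lam).-integrable setT (fun p => `|f p|%:E * weight nu k p.1).
Proof.
move=> T0 mf f0 M0 fM.
have mw : measurable_fun setT (fun p : spacetime => weight nu k p.1).
  exact: (measurableT_comp (measurable_weight nu k)).
have mI : measurable_fun setT (fun t : measurableTypeR R => (\1_(`]0%R, T[%classic) t : R)%:E).
  by apply/measurable_EFinP; exact: measurable_indic.
apply/integrableP; split.
  by apply: emeasurable_funM => //; apply/measurable_EFinP; exact: measurableT_comp.
pose g (p : spacetime) := (M%:E * (\1_(`]0%R, T[%classic) p.2 : R)%:E) * weight nu k p.1.
have mg : measurable_fun setT g.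
  apply: emeasurable_funM => //; apply: emeasurable_funM => //.
  exact: (measurableT_comp mI).
have g0 p : 0 <= g p.
  by rewrite !mule_ge0 ?weight_ge0.
apply: (@le_lt_trans _ _ (\int[leb \x lam]_p g p)).
  apply: ae_ge0_le_integral => //.
    apply: measurableT_comp => //.
    by apply: emeasurable_funM => //; apply/measurable_EFinP; exact: measurableT_comp.
  apply: filterS fM => p fpM _.
  rewrite gee0_abs ?mule_ge0 ?weight_ge0 ?lee_fin//.
  rewrite /g lee_wpmul2r ?weight_ge0// -EFinM lee_fin indicE.
  have [pT|pT] := pselect (cylinder T p); last by rewrite f0// normr0 mulr_ge0.
  by rewrite mem_set ?mulr1//= in_itv.
rewrite (fubini_tonelli1 (m1 := leb) (m2 := lam) g mg g0) /fubini_F /g /=.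
have E x : \int[lam]_t ((M%:E * (\1_(`]0%R, T[%classic) t : R)%:E) * weight nu k x) =
    (M * T)%:E * weight nu k x.
  rewrite ge0_integralZr ?weight_ge0//; last 2 first.
  - exact: emeasurable_funM.
  - by move=> t _; rewrite mule_ge0 ?lee_fin.
  rewrite ge0_integralZl ?lee_fin//.
  rewrite integral_indic// setIT EFinM; congr (_ * _ * _).
  by apply: (etrans (lebesgue_measure_itv _)); rewrite /= lte_fin T0 oppr0 adde0.
under eq_integral do rewrite E.
have MT0 : 0 <= (M * T)%:E by rewrite lee_fin mulr_ge0// ltW.
rewrite (ge0_integralZl leb measurableT (measurable_weight nu k) (fun x _ => weight_ge0 nu k x) MT0).
by rewrite lte_mul_pinfty// integral_weight_lty.
Qed.

Lemma ae_weight_lty (k : nat) (f : spacetime -> R) :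
  (leb \x lam).-integrable setT (fun p => `|f p|%:E * weight nu k p.1) ->
  {ae lam, forall t, \int[leb]_x (`|f (x, t)|%:E * weight nu k x) < +oo}.
Proof.
move=> /ae_integrable2; apply: filterS => t /integrableP[_].
by under eq_integral do rewrite /= gee0_abs ?mule_ge0 ?weight_ge0 ?lee_fin//.
Qed.

End fixed_nu.

End weighted_spacetime.

(** * Equality of the space-time terms of the two weak formulations *)

Section weak_formulations.
Context {R : realType} {N : nat} (T : R) (phi : R -> R).
Variables (mu : {measure set 'rV[R]_N -> \bar R}) (u : 'rV[R]_N * R -> R).
Hypotheses (T0 : 0 < T) (phi_continuous : continuous phi)
  (phi_nondecreasing : {homo phi : x y / x <= y})
  (mu_even : even_measure mu) (mu_levy : levy_integrable mu)
  (u_Linfty : Linfty_cylinder T u)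
  (u_measurable : @measurable_fun _ _ ('rV[R]_N * measurableTypeR R)%type R (cylinder T) u)
  (phiu_energy : L2_energy T mu (phi \o u)).
Local Open Scope ereal_scope.
Local Notation spacetime := ('rV[R]_N * measurableTypeR R)%type.
Local Notation leb := (lebesgue_rV N).
Local Notation lam := (@lebesgue_measure R).

Lemma weak_form_eq (psi : 'rV[R]_N * R -> R) : test_function T psi ->
  \int[lam]_(t in `]0%R, T[)
    (\int[leb]_x (u (x, t) * dt psi (x, t))%:E
     - energy mu (slice (phi \o u) t) (slice psi t)) =
  \int[leb \x lam]_(p in cylinder T)
    (u p * dt psi p + phi (u p) * levy_operator mu (slice psi p.2) p.1)%:E.
Proof.
move=> tpsi; have [spsi _] := tpsi.
have [nu [nu_even nu_kappa nuE]] := levy_sigma_finite mu_even mu_levy.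
have [k [C [C0 bnds]]] := test_function_bounds tpsi.
have [M M0 UM] := Linfty_cylinder_bounded u_Linfty.
have mcyl := @measurable_cylinder R N T.
(* Values outside the cylinder are arbitrary. Extension by zero gives functions measurable on all of
   space-time. *)
pose U : spacetime -> R := (u \_ (cylinder T))%R.
pose F : spacetime -> R := ((phi \o u) \_ (cylinder T))%R.
have mU : measurable_fun setT U by exact: ((@measurable_restrictT _ _ spacetime _ _ u mcyl).1 u_measurable).
have mF : measurable_fun setT F.
  apply: (@measurable_restrictT _ _ spacetime _ _ (phi \o u) mcyl).1.
  apply: (measurableT_comp _ u_measurable).
  exact: continuous_measurable_fun.
have FM := ae_bounded_comp phi_nondecreasing UM.
have U0 p : ~ cylinder T p -> U p = 0%R by exact: cylinderF.
have F0 p : ~ cylinder T p -> F p = 0%R by exact: cylinderF.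
have iU : (leb \x lam).-integrable setT (fun p => `|U p|%:E * weight nu k p.1).
  exact: (integrable_weight_spacetime nu_kappa k T0 mU U0 M0 UM).
have iF : (leb \x lam).-integrable setT (fun p => `|F p|%:E * weight nu k p.1).
  apply: (integrable_weight_spacetime nu_kappa k T0 mF F0 _ FM).
  by rewrite addr_ge0.
have mpsi : measurable_fun setT (psi : spacetime -> R).
  by apply: continuous_measurable_rV_R; exact: smooth_continuous.
have mD v : measurable_fun setT ('D_v psi : spacetime -> R).
  apply: continuous_measurable_rV_R; apply: (smooth_continuous (f := 'D_v psi)).
  exact: smooth_derive.
have mdt : measurable_fun setT (dt psi : spacetime -> R).
  rewrite (_ : (dt psi : spacetime -> R) = 'D_((0, 1)%R : 'rV[R]_N * R) psi)//.
  by apply/funext => p; exact: dt_derive.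
have mgrad i : measurable_fun setT (fun p : spacetime => gradient (slice psi p.2) p.1 ord0 i).
  rewrite (_ : (fun _ => _) = ('D_(space_dir i) psi : spacetime -> R))//.
  by apply/funext => -[x t]; rewrite gradient_slice.
have munit : measurable_fun setT (\1_(@unit_ball R N) : 'rV[R]_N -> R).
  by apply: measurable_indic; exact: measurable_unit_ball.
have mshift (f : spacetime -> R) : measurable_fun setT f ->
    measurable_fun setT (fun q : spacetime * 'rV[R]_N => f ((q.1.1 + q.2)%R, q.1.2)).
  move=> mf; apply: (measurableT_comp mf); apply: measurable_fun_pair => /=.
    apply: (measurableT_comp (@measurable_addrV R N)
      (g := fun q : spacetime * 'rV[R]_N => (q.1.1, q.2))).
    apply: measurable_fun_pair => //.
    by apply: measurableT_comp => //; exact: measurable_fst.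
  by apply: measurableT_comp => //; exact: measurable_snd.
have mtau : measurable_fun setT
    (fun q : spacetime * 'rV[R]_N => taylor (slice psi q.1.2) q.1.1 q.2).
  apply: measurable_funB.
    apply: measurable_funB; first exact: mshift.
    rewrite (_ : (fun _ => _) = psi \o fst); first exact: (measurableT_comp mpsi).
    by apply/funext => -[[]].
  apply: measurable_funM; last exact: (measurableT_comp munit).
  apply: (@measurable_sum _ _ _ _ _ (index_enum 'I_N) (fun i (q : spacetime * 'rV[R]_N) =>
    (q.2 ord0 i * gradient (slice psi q.1.2) q.1.1 ord0 i)%R)) => i.
  apply: measurable_funM; first exact: (measurableT_comp (@measurable_coordrV _ _ i)).
  exact: (measurableT_comp (mgrad i)).
(* The Levy operator applied to psi, as an integral against [nu]; joint measurability of the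
   integrand makes it measurable in space-time. *)
pose L (p : spacetime) : R := (\int[nu]_z taylor (slice psi p.2) p.1 z)%R.
have mL : measurable_fun setT L.
  apply: measurableT_comp => //.
  apply: (measurable_fun_integral2 nu (S := spacetime)
    (f := fun q => (taylor (slice psi q.1.2) q.1.1 q.2)%:E)).
  exact/measurable_EFinP.
have LE p : levy_operator mu (slice psi p.2) p.1 = L p.
  congr fine; apply: (nuE (fun z => (taylor (slice psi p.2) p.1 z)%:E)).
  by apply/measurable_EFinP; exact: (measurable_fun_pair2 p mtau).
pose A (p : spacetime) : R := (U p * dt psi p + F p * L p)%R.
have mA : measurable_fun setT A.
  by apply: measurable_funD; exact: measurable_funM.
have mslice (f : spacetime -> R) t : measurable_fun setT f ->
    measurable_fun setT (fun x => f (x, t)).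
  exact: measurable_fun_pair1.
have Lw x t : (0 < t < T)%R -> `|L (x, t)|%:E <= C%:E * weight nu k x.
  move=> tT; have [_ _ b3 _] := bnds _ tT.
  apply: (Rintegral_taylor_bound nu_kappa C0 (psi := slice psi t)).
  - exact: mslice.
  - by move=> i; exact: (mslice _ t (mgrad i)).
  - by move=> y z; rewrite /cutoff mulrA.
have dtw x t : (0 < t < T)%R -> `|dt psi (x, t)|%:E <= C%:E * weight nu k x.
  move=> tT; have [b1 _ _ _] := bnds _ tT.
  apply: (@le_trans _ _ (C%:E * (\1_(cube k) x)%:E)); first by rewrite -EFinM lee_fin.
  rewrite lee_wpmul2l ?lee_fin// leeDl// integral_ge0// => z _.
  by rewrite lee_fin cutoff_ge0.
(* The dominating function is C (|U| + |F|) [weight], as both the time derivative and L are at most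
   C [weight]. *)
have iA : (leb \x lam).-integrable setT (EFin \o A).
  have iCU := integrableZl measurableT C iU.
  have iCF := integrableZl measurableT C iF.
  apply: (le_integrable measurableT _ _ (integrableD measurableT iCU iCF)).
    exact/measurable_EFinP.
  have ge0 (f : spacetime -> R) p : 0 <= C%:E * (`|f p|%:E * weight nu k p.1).
    by apply: mule_ge0; rewrite ?lee_fin//; apply: mule_ge0 => //; exact: weight_ge0.
  move=> -[x t] _; rewrite [leRHS]gee0_abs; last by apply: adde_ge0; exact: ge0.
  rewrite /A /=; have [xtT|xtT] := pselect (cylinder T (x, t)); last first.
    rewrite U0// F0// !mul0r addr0 normr0.
    by apply: adde_ge0; [have := ge0 (cst 0%R) (x, t)|have := ge0 (cst 0%R) (x, t)];
      rewrite /= normr0.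
  apply: (@le_trans _ _ (`|U (x, t) * dt psi (x, t)|%:E + `|F (x, t) * L (x, t)|%:E)).
    by rewrite -EFinD lee_fin ler_normD.
  rewrite !normrM !EFinM leeD//.
    by rewrite muleCA lee_wpmul2l ?lee_fin// dtw.
  by rewrite muleCA lee_wpmul2l ?lee_fin// Lw.
have mFdiff : measurable_fun setT (fun q : spacetime * 'rV[R]_N =>
    (F ((q.1.1 + q.2)%R, q.1.2) - F q.1)%R).
  by apply: measurable_funB; [exact: mshift|exact: (measurableT_comp mF)].
have mpsidiff : measurable_fun setT (fun q : spacetime * 'rV[R]_N =>
    (psi ((q.1.1 + q.2)%R, q.1.2) - psi q.1)%R).
  by apply: measurable_funB; [exact: mshift|exact: (measurableT_comp mpsi)].
have mswap : measurable_fun setT (fun p : measurableTypeR R * 'rV[R]_N => (p.2, p.1) : spacetime).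
  exact: measurable_swap.
have mint (f : spacetime * 'rV[R]_N -> R) : measurable_fun setT f ->
    measurable_fun setT (fun t : measurableTypeR R => \int[leb]_x \int[nu]_z (f ((x, t), z))%:E).
  move=> mf.
  have mEf : measurable_fun setT (EFin \o f) by exact/measurable_EFinP.
  have mf1 := measurable_fun_integral2 nu mEf.
  exact: (measurable_fun_integral2 leb (measurableT_comp mf1 mswap)).
pose EF t := \int[leb]_x \int[nu]_z ((F ((x + z)%R, t) - F (x, t)) ^+ 2)%:E.
pose EG t := \int[leb]_x \int[nu]_z
  ((F ((x + z)%R, t) - F (x, t)) * (psi ((x + z)%R, t) - psi (x, t)))%:E.
have mEF : measurable_fun setT (EF : measurableTypeR R -> _).
  exact: (mint (fun q => (F ((q.1.1 + q.2)%R, q.1.2) - F q.1) ^+ 2)%R (measurable_funX _ mFdiff)).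
have mEG : measurable_fun setT (EG : measurableTypeR R -> _).
  exact: (mint (fun q => (F ((q.1.1 + q.2)%R, q.1.2) - F q.1) *
    (psi ((q.1.1 + q.2)%R, q.1.2) - psi q.1))%R (measurable_funM mFdiff mpsidiff)).
have Ft x t : (0 < t < T)%R -> F (x, t) = phi (u (x, t)).
  by move=> tT; rewrite /F cylinderT.
have energyE (f g : 'rV[R]_N -> R) : measurable_fun setT f -> measurable_fun setT g ->
    energy mu f g = (2^-1)%:E * \int[leb]_x \int[nu]_z
      ((f (x + z)%R - f x) * (g (x + z)%R - g x))%:E.
  move=> mf mg; congr (_ * _); apply: eq_integral => x _.
  apply: (nuE (fun z => ((f (x + z)%R - f x) * (g (x + z)%R - g x))%:E)).
  have mx (h : 'rV[R]_N -> R) : measurable_fun setT h ->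
      measurable_fun setT (fun z => (h (x + z) - h x)%R).
    move=> mh; apply: measurable_funB => //; apply: (measurableT_comp mh).
    exact: (measurableT_comp (@measurable_addrV R N) (pair1_measurable x)).
  by apply/measurable_EFinP; apply: measurable_funM; exact: mx.
have sliceF t : (0 < t < T)%R -> slice (phi \o u) t = fun x => F (x, t).
  by move=> tT; apply/funext => x; rewrite Ft.
have EF_ge0 t : 0 <= EF t.
  rewrite integral_ge0// => x _.
  by rewrite integral_ge0// => z _; rewrite lee_fin sqr_ge0.
(* The energy is integrable in time, hence finite at almost every time. *)
have EFoo : {ae lam, forall t, `]0%R, T[%classic t -> EF t < +oo}.
  have [_ L2] := phiu_energy.
  have iEF : lam.-integrable `]0%R, T[ (fun t => (2^-1)%:E * EF t).
    apply/integrableP; split.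
      by apply: emeasurable_funM; [exact: measurable_cst|exact: (measurable_funTS mEF)].
    apply: le_lt_trans L2; rewrite le_eqVlt; apply/orP; left; apply/eqP.
    apply: eq_integral => t /set_mem; rewrite /= in_itv/= => tT.
    rewrite gee0_abs; last by rewrite mule_ge0 ?lee_fin ?invr_ge0.
    rewrite sliceF// energyE; [|exact: mslice|exact: mslice].
    by congr (_ * _).
  move/integrable_ae: iEF => /(_ (measurable_itv _)); apply: filterS => t /[apply].
  have := EF_ge0 t.
  by case: (EF t) => [r| |]//= _; rewrite ?ltry// gt0_muley// lte_fin invr_gt0.
pose I1 t := \int[leb]_x (U (x, t) * dt psi (x, t))%:E - (2^-1)%:E * EG t.
pose I2 t := \int[leb]_x (A (x, t))%:E.
have mUd : measurable_fun setT (fun p : spacetime => U p * dt psi p)%R.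
  exact: measurable_funM.
have mI1 : measurable_fun setT (I1 : measurableTypeR R -> _).
  apply: emeasurable_funB; last exact: emeasurable_funM.
  have mEUd : measurable_fun setT (EFin \o (fun p : spacetime => U p * dt psi p)%R).
    exact/measurable_EFinP.
  exact: (measurable_fun_integral2 leb (measurableT_comp mEUd mswap)).
have mI2 : measurable_fun setT (I2 : measurableTypeR R -> _).
  exact: (measurable_fubini_G iA).
transitivity (\int[lam]_(t in `]0%R, T[) I1 t).
  apply: eq_integral => t /set_mem; rewrite /= in_itv/= => tT.
  rewrite /I1 sliceF// energyE; [|exact: mslice|exact: mslice].
  congr (_ - _); apply: eq_integral => x _.
  by rewrite /U cylinderT.
transitivity (\int[lam]_(t in `]0%R, T[) I2 t).
  (* The identity at fixed time requires finite weighted integrals of U and F and finite energy of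
     F. These three conditions hold together at almost every time. *)
  suff I12 : {ae lam, forall t, `]0%R, T[%classic t -> I1 t = I2 t}.
    by apply: ae_eq_integral; [|exact: measurable_funTS mI1|exact: measurable_funTS mI2|exact: I12].
  have [ae_U ae_F] := (ae_weight_lty iU, ae_weight_lty iF).
  move: ae_U ae_F EFoo; apply: (@filterS3 _ _ (ae_filter_ringOfSetsType lam)) => t Uoo Foo EFoo' tT0.
  have {}EFoo' := EFoo' tT0; move: tT0; rewrite /= in_itv/= => tT.
  have [b1 b2 b3 b4] := bnds _ tT.
  have [iFL EFL] : leb.-integrable setT (fun x => (F (x, t) * L (x, t))%:E) /\
      (2^-1)%:E * EG t = - \int[leb]_x (F (x, t) * L (x, t))%:E.
    apply: (energy_taylor nu_even nu_kappa (F := fun x => F (x, t)) (psi := slice psi t)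
      (k := k) (C := C)) => //.
    - exact: mslice.
    - exact: mslice.
    - by move=> i; exact: (mslice _ t (mgrad i)).
    - by move=> x z; rewrite /cutoff mulrA.
    - by move=> x z; rewrite /cutoff mulrA.
  have iUd : leb.-integrable setT (fun x => (U (x, t) * dt psi (x, t))%:E).
    have mUdt : measurable_fun setT (fun x => (U (x, t) * dt psi (x, t))%:E).
      by apply/measurable_EFinP; exact: (mslice _ t mUd).
    have mUw : measurable_fun setT (fun x => `|U (x, t)|%:E * weight nu k x).
      apply: emeasurable_funM; last exact: measurable_weight.
      by apply/measurable_EFinP; apply: measurableT_comp => //; exact: mslice.
    have Uw0 x : 0 <= `|U (x, t)|%:E * weight nu k x.
      by apply: mule_ge0; rewrite ?lee_fin//; exact: weight_ge0.
    apply/integrableP; split => //.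
    apply: (@le_lt_trans _ _ (\int[leb]_x (C%:E * (`|U (x, t)|%:E * weight nu k x)))).
      apply: ge0_le_integral => //.
      - exact: measurableT_comp.
      - exact: emeasurable_funM.
      move=> x _; rewrite /= normrM EFinM muleCA lee_wpmul2l ?lee_fin//.
      exact: dtw.
    by rewrite ge0_integralZl// lte_mul_pinfty.
  rewrite /I1 /I2 EFL oppeK /A; under [RHS]eq_integral do rewrite EFinD.
  by rewrite integralD.
(* [A] vanishes outside the cylinder, so both domains extend to the full line and the full
   space-time, where Fubini applies. *)
rewrite [RHS]integral_mkcond [LHS]integral_mkcond.
transitivity (\int[lam]_t fubini_G leb (EFin \o A) t).
  apply: eq_integral => t _; rewrite patchE; case: ifPn => //.
  rewrite notin_setE/= in_itv/= => ntT; rewrite /fubini_G integral0_eq// => x _ /=.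
  by rewrite /A U0// F0// !mul0r addr0.
rewrite (integral21_prod_meas1 iA); apply: eq_integral => p _.
rewrite patchE; case: ifPn => [/set_mem pT|].
  by rewrite /= /A /U /F !cylinderT//= LE.
by rewrite notin_setE => pT; rewrite /A /= U0// F0// !mul0r addr0.
Qed.

End weak_formulations.

Theorem theorem2p12 (R : realType) (N : nat) (T : R) (phi : R -> R)
    (mu : {measure set 'rV[R]_N -> \bar R})
    (u0 : 'rV[R]_N -> R) (u : 'rV[R]_N * R -> R)
    (T_gt0 : 0 < T)
    (phi_continuous : continuous phi)
    (phi_nondecreasing : {homo phi : x y / x <= y})
    (mu_radon : radon_punctured mu)
    (mu_even : even_measure mu)
    (mu_levy : levy_integrable mu)
    (u0_Linfty : u0 \in Lfun (lebesgue_rV N) +oo%E)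
    (u_Linfty : Linfty_cylinder T u) :
  energy_solution T mu phi u0 u <->
  distributional_solution T mu phi u0 u /\ L2_energy T mu (phi \o u).
Proof.
split=> [[uL1 uE weak]|[[uL1 weak] uE]].
  (* The finite energy of phi(u), required by [weak_form_eq], is part of (a) and an explicit clause
     of (b), so the same rewriting serves both directions. *)
  split=> //; split=> // psi tpsi.
  by rewrite -(weak_form_eq T_gt0 _ _ _ _ _ uL1.1 uE tpsi)// weak.
split=> // psi tpsi.
by rewrite (weak_form_eq T_gt0 _ _ _ _ _ uL1.1 uE tpsi)// weak.
Qed.
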